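(* Let $v \in I^{\mathsf{FPF}}_\infty$ and let $j,k \in \mathbb{P}$ satisfy $v(k) = j < k = v(j)$. Let $$1 \leq i_1 < i_2 < \dots < i_p < j < k < l_q < \dots < l_2 < l_1$$ be such that $i_1,\dots,i_p$ are exactly the integers $i$ with $1\le i<j$ and $v \lessdot_F (i,j)v(i,j)$, and $l_1,\dots,l_q$ are exactly the integers $l>k$ with $v \lessdot_F (k,l)v(k,l)$. Then $$(1+\beta x_j)(1+\beta x_k)\Bigl[\mathfrak{G}^{\mathsf{Sp}}_v\cdot (1+\beta \mathfrak{u}_{i_1 j})(1+\beta \mathfrak{u}_{i_2 j})\cdots(1+\beta \mathfrak{u}_{i_p j})\Bigr] = \mathfrak{G}^{\mathsf{Sp}}_v\cdot (1+\beta \mathfrak{u}_{k l_1})(1+\beta \mathfrak{u}_{k l_2})\cdots(1+\beta \mathfrak{u}_{k l_q}).$$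
   Context: Let $\mathbb{P}=\{1,2,3,\dots\}$, and let $\beta,x_1,x_2,\dots$ be commuting indeterminates. $S_\infty$ is the group of permutations of $\mathbb{P}$ with finite support; $(i,j)$ denotes the transposition of $i$ and $j$, and $s_i=(i,i+1)$. Let $\Theta:\mathbb{P}\to\mathbb{P}$ be $i\mapsto i-(-1)^i$, so $\Theta=(1,2)(3,4)(5,6)\cdots$, and let $I^{\mathsf{FPF}}_\infty=\{w^{-1}\Theta w: w\in S_\infty\}$ (fixed-point-free involutions of $\mathbb{P}$ agreeing with $\Theta$ at all sufficiently large integers). For $n\in 2\mathbb{P}$, $n\cdots 321$ denotes the element of $I^{\mathsf{FPF}}_\infty$ sending $i\mapsto n+1-i$ for $i\le n$ and $i\mapsto\Theta(i)$ for $i>n$. For $i\in\mathbb{P}$ and $f$ in $\mathbb{Z}[\beta][x_1^{\pm1},x_2^{\pm1},\dots]$, let $s_if$ be $f$ with $x_i,x_{i+1}$ interchanged, $\partial_i f=\frac{f-s_if}{x_i-x_{i+1}}$, and $\partial^{(\beta)}_i f=\partial_i((1+\beta x_{i+1})f)$. The symplectic Grothendieck polynomials are the unique family $\{\mathfrak{G}^{\mathsf{Sp}}_z\}_{z\in I^{\mathsf{FPF}}_\infty}\subset\mathbb{Z}[\beta][x_1,x_2,\dots]$ with $\mathfrak{G}^{\mathsf{Sp}}_{n\cdots321}=\prod_{1\le i<j\le n-i}(x_i+x_j+\beta x_ix_j)$ for all $n\in2\mathbb{P}$ and $\partial^{(\beta)}_i\mathfrak{G}^{\mathsf{Sp}}_z=\mathfrak{G}^{\mathsf{Sp}}_{s_izs_i}$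 whenever $i+1\ne z(i)>z(i+1)\ne i$. This family exists, is unique, and is linearly independent over $\mathbb{Z}[\beta]$. For $z\in I^{\mathsf{FPF}}_\infty$ let $\ell_{\mathsf{FPF}}(z)=|\{(i,j)\in\mathbb{P}\times\mathbb{P}: z(i)>z(j)<i<j\}|$. For $y,z\in I^{\mathsf{FPF}}_\infty$ write $y\lessdot_F z$ if $\ell_{\mathsf{FPF}}(z)=\ell_{\mathsf{FPF}}(y)+1$ and $z=tyt$ for some transposition $t\in S_\infty$. For distinct $i,j\in\mathbb{P}$, $\mathfrak{u}_{ij}$ is the $\mathbb{Z}[\beta]$-linear operator, acting on the right on the span of the symplectic Grothendieck polynomials, with $\mathfrak{G}^{\mathsf{Sp}}_z\mathfrak{u}_{ij}=\mathfrak{G}^{\mathsf{Sp}}_{(i,j)z(i,j)}$ for $z\in I^{\mathsf{FPF}}_\infty$. Products of such operators are applied from left to right. *)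

(* Defs.v *)
(* The positive integers are encoded 0-based throughout: the natural number
   n stands for the positive integer n.+1. Hence s_ i exchanges i and i.+1,
   x_ i is the paper's variable with index i.+1, and only formulas that use
   the value of an index (Theta, wrev, GSp_top) look different. *)
From HB Require Import structures.
From mathcomp Require Import all_boot all_order all_algebra finmap.
From mathcomp Require Import boolp classical_sets functions cardinality.
From mathcomp.multinomials Require Import monalg.

Set Implicit Arguments.
Unset Strict Implicit.
Unset Printing Implicit Defensive.

Import GRing.Theory.

Local Open Scope ring_scope.

(* 0-based form of i |-> i - (-1)^i, that is (1,2)(3,4)(5,6)... *)
Definition Theta (i : nat) : nat := if odd i then i.-1 else i.+1.

Definition transp (i j : nat) : nat -> nat :=
  fun a => if a == i then j else if a == j then i else a.

(* t z t for an involution t *)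
Definition conj_by (t z : nat -> nat) : nat -> nat := t \o z \o t.

(* w ranges over the permutations with finite support; w' is its inverse *)
Definition IFPF (z : nat -> nat) : Prop :=
  exists w w' : nat -> nat,
    [/\ cancel w w', cancel w' w,
        finite_set [set i | w i != i]%classic
      & z =1 w' \o Theta \o w].

(* the involution n ... 3 2 1, i.e. i |-> n + 1 - i for 1-based i <= n *)
Definition wrev (n : nat) : nat -> nat :=
  fun i => if (i < n)%N then (n - i.+1)%N else Theta i.

Definition fpf_inversions (z : nat -> nat) : set (nat * nat) :=
  [set p | (z p.2 < z p.1)%N /\ (z p.2 < p.1 < p.2)%N]%classic.

(* fpf_inversions z is finite when z is in IFPF *)
Definition ellFPF (z : nat -> nat) : nat := #|` fset_set (fpf_inversions z)|.

Definition fpf_cover (y z : nat -> nat) : Prop :=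
  ellFPF z = (ellFPF y).+1 /\
  exists a b : nat, a != b /\ z =1 conj_by (transp a b) y.

(* polynomials in countably many variables are linear combinations of finitely
   supported commutative monomials; beta is the variable of the coefficient
   ring; the structures are fixed by these definitions to keep unification
   fast *)
Definition Zbeta : idomainType := {poly int}.
Definition xmonom : conomType := {cmonom nat}.
Definition ZbetaX : comAlgType Zbeta := {malg Zbeta[xmonom]}.

Definition beta : Zbeta := 'X.

Definition x_ (i : nat) : ZbetaX := << ucm i >>.

(* Z[beta]-linear substitution of h a for the variable x_ a *)
Definition subst_vars (h : nat -> ZbetaX) (f : ZbetaX) : ZbetaX :=
  mmap (fun c : Zbeta => c%:MP)
       (fun m : {cmonom nat} => \prod_(a <- finsupp m) h a ^+ m a) f.

Definition s_ (i : nat) (f : ZbetaX) : ZbetaX :=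
  subst_vars (fun a => x_ (transp i i.+1 a)) f.

(* g is the quotient (f - s_i f) / (x_i - x_{i+1}); since ZbetaX is an
   integral domain there is only one such g *)
Definition is_divdiff (i : nat) (f g : ZbetaX) : Prop :=
  (x_ i - x_ i.+1) * g = f - s_ i f.

Definition is_bdivdiff (i : nat) (f g : ZbetaX) : Prop :=
  is_divdiff i ((1 + beta *: x_ i.+1) * f) g.

(* the product over 1-based indices 1 <= i < j <= n - i *)
Definition GSp_top (n : nat) : ZbetaX :=
  \prod_(i < n) \prod_(j < n | (i < j)%N && (i.+1 + j.+1 <= n)%N)
    (x_ i + x_ j + beta *: (x_ i * x_ j)).

(* Only the values of G on IFPF are constrained. *)
Definition symplectic_Grothendieck (G : (nat -> nat) -> ZbetaX) : Prop :=
  (forall n : nat, (0 < n)%N -> ~~ odd n -> G (wrev n) = GSp_top n) /\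
  (forall (z : nat -> nat) (i : nat), IFPF z ->
     z i != i.+1 -> (z i.+1 < z i)%N -> z i.+1 != i ->
     is_bdivdiff i (G z) (G (conj_by (transp i i.+1) z))).

Definition in_span (G : (nat -> nat) -> ZbetaX) (f : ZbetaX) : Prop :=
  exists (n : nat) (c : 'I_n -> Zbeta) (z : 'I_n -> nat -> nat),
    (forall a, IFPF (z a)) /\ f = \sum_(a < n) c a *: G (z a).

(* T restricts to the operator u_ij on the span of G; its values outside the
   span are irrelevant *)
Definition is_u (G : (nat -> nat) -> ZbetaX) (i j : nat)
    (T : ZbetaX -> ZbetaX) : Prop :=
  (forall (c : Zbeta) (f g : ZbetaX), in_span G f -> in_span G g ->
     T (c *: f + g) = c *: T f + T g) /\
  (forall z : nat -> nat, IFPF z -> T (G z) = G (conj_by (transp i j) z)).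

(* f (1 + beta T_1) (1 + beta T_2) ... (1 + beta T_r), applied from left to
   right, for the list of operators [:: T_1; T_2; ...; T_r] *)
Definition act_right (f : ZbetaX) (Ts : seq (ZbetaX -> ZbetaX)) : ZbetaX :=
  foldl (fun g T => g + beta *: T g) f Ts.

(* Main.v *)
From HB Require Import structures.
Require Import Defs.
From mathcomp Require Import all_boot all_order all_algebra finmap.
From mathcomp Require Import boolp classical_sets functions cardinality.
From mathcomp.multinomials Require Import monalg.
From mathcomp Require Import zify ring.

Set Implicit Arguments.
Unset Strict Implicit.
Unset Printing Implicit Defensive.

Import GRing.Theory.

Local Open Scope ring_scope.

                               

(** Expanding the products of operators turns each side into a sum over the subsets S of a list of
    covers. The subset S contributes beta to the power |S| times G at the involution reached from v
    by the conjugations in S ([chain_sum], [word]). The identity between the two sums is proved by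
    descending induction inside the involutions supported on an even initial segment. The start is
    the reversal [wrev n]. Any other z has an ascent i, and the identity for z follows by applying
    the operator [bdivdiff] at i to both sides of the identity for the longer involution s_i z s_i.

    The operator acts simply on one polynomial ([bdivdiff_demazure]). At a descent of w that is not
    an arc it gives G at s_i w s_i. Otherwise G w is symmetric in x_i and x_{i+1}, and it is
    multiplied by -beta. At an ascent the symmetry holds because G w is itself in the image of the
    operator. At an arc w(i) = i+1 it needs a braid argument ([G_arc_sym]).

    The action on a whole chain is combinatorial. Let p and q be the two exchanged points, listed in
    the order that orients the chain. If neither endpoint of the distinguished arc is p, the chain
    of z goes exactly to the chain of its conjugate. The words whose descent has been destroyed
    cancel against words using one letter more ([transition_away], through [chain_sum_cancel]). If
    one endpoint is p, the new chain is the image plus beta times the old chain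
    ([transition_opener], [transition_closer]). These corrections match the twisted Leibniz rules
    for the factors 1 + beta x ([bdivdiff_xi], [bdivdiff_xSi]), so the induction closes in
    [transition_step].

    At the reversal the left list is empty and the right list has one element. The identity then
    says that conjugating [wrev n] by the transposition of k and n multiplies G by x_j + x_k + beta
    x_j x_k ([G_base]). This is obtained from [wrev (n + 2)] by divided differences that each strip
    one factor from the product formula.

    Left and right covers are mirror images, so the combinatorics is done once, for an order on the
    integers chosen by a Boolean. The lemmas [fpf_cover_left] and [fpf_cover_right] translate the
    length condition into the pattern condition [cover_cond]. *)

Definition fpf_involution (z : nat -> nat) : Prop :=
  (forall x, z (z x) = x) /\ (forall x, z x <> x).

(** * Transpositions and conjugation by them *)

Lemma transpL a b : transp a b a = b.
Proof. by rewrite /transp eqxx. Qed.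

Lemma transpR a b : transp a b b = a.
Proof. by rewrite /transp eqxx; case: eqP. Qed.

Lemma transpN a b x : x <> a -> x <> b -> transp a b x = x.
Proof. by rewrite /transp => /eqP/negPf-> /eqP/negPf->. Qed.

Lemma transpK a b : involutive (transp a b).
Proof.
move=> x; rewrite /transp; case: (eqVneq x a) => [->|xa].
  by rewrite eqxx; case: eqP.
by case: (eqVneq x b) => [->|xb]; rewrite ?eqxx // (negPf xa) (negPf xb).
Qed.

Lemma transpC a b : transp a b = transp b a.
Proof.
apply/funext => x; rewrite /transp.
by case: (eqVneq x a) => [->|//]; case: eqP.
Qed.

Lemma conj_byK a b z : conj_by (transp a b) (conj_by (transp a b) z) = z.
Proof. by apply/funext => x; rewrite /conj_by /= !transpK. Qed.

Lemma transp_transp a b c d x :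
  transp a b (transp c d x) = transp (transp a b c) (transp a b d) (transp a b x).
Proof.
have inj := can_inj (transpK a b).
rewrite [transp c d x]/transp [transp (transp a b c) _ _]/transp !(inj_eq inj).
by case: ifP => // _; case: ifP.
Qed.

Lemma conj_by_conj a b c d z :
  conj_by (transp a b) (conj_by (transp c d) z) =
  conj_by (transp (transp a b c) (transp a b d)) (conj_by (transp a b) z).
Proof.
apply/funext => x; rewrite /conj_by /= transp_transp.
have e := transp_transp a b c d (transp a b x).
by rewrite transpK in e; rewrite -e transpK.
Qed.

Lemma conj_fpf a b z : fpf_involution z -> fpf_involution (conj_by (transp a b) z).
Proof.
case=> zK zN; split=> x; rewrite /conj_by /=; first by rewrite !transpK zK transpK.
by move=> /(congr1 (transp a b)); rewrite transpK => /zN.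
Qed.

(** * Successive conjugations through a fixed point j *)

Section Word.
Variable j : nat.
Definition word (z : nat -> nat) (S : seq nat) : nat -> nat :=
  foldl (fun w a => conj_by (transp a j) w) z S.

Lemma word_cat z S1 S2 : word z (S1 ++ S2) = word (word z S1) S2.
Proof. exact: foldl_cat. Qed.

Lemma word_fpf z S : fpf_involution z -> fpf_involution (word z S).
Proof. by elim: S z => //= a S IH z hz; apply/IH/conj_fpf. Qed.

Lemma conj_swap z a : fpf_involution z -> a <> j -> a <> z j ->
  [/\ conj_by (transp a j) z a = z j, conj_by (transp a j) z (z j) = a,
      conj_by (transp a j) z j = z a, conj_by (transp a j) z (z a) = j
    & forall x, x <> a -> x <> j -> x <> z a -> x <> z j ->
        conj_by (transp a j) z x = z x].
Proof.
move=> [zK zN] aj azj.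
have zja : z j <> a by move/esym.
have [zNa zNj] := (zN a, zN j).
have zaj : z a <> j by move=> h; apply: azj; rewrite -h zK.
rewrite /conj_by /=; split.
- by rewrite transpL transpN.
- by rewrite (transpN zja) ?zK ?transpR.
- by rewrite transpR transpN.
- by rewrite (transpN zNa zaj) zK transpL.
move=> x xa xj xza xzj; rewrite (transpN xa xj) transpN //.
  by move=> h; apply: xza; rewrite -h zK.
by move=> h; apply: xzj; rewrite -h zK.
Qed.

                                                                                
(** Conjugating by the transposition of a and j makes a and j trade partners. Reading a whole word
    therefore shifts the partners cyclically: the first letter takes the partner of j, every later
    letter takes that of its predecessor, and j ends with that of the last letter. The disjointness
    hypotheses keep the arcs of distinct letters and of j apart. *)
Lemma wordP z S : fpf_involution z -> uniq S ->
  (forall a : nat, a \in S -> a <> j /\ a <> z j) ->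
  (forall a a' : nat, a \in S -> a' \in S -> z a <> a') ->
  [/\ forall x : nat, x \notin S -> z x \notin S -> x <> j -> x <> z j ->
        word z S x = z x,
      word z S j = last (z j) (map z S),
      word z S (z j) = head j S
    & forall (S1 : seq nat) (a : nat) (S2 : seq nat), S = S1 ++ a :: S2 ->
        word z S a = last (z j) (map z S1) /\ word z S (z a) = head j S2].
Proof.
elim: S z => [|a S IH] z hz /=.
  case: (hz) => zK _ _ _ _; split => //.
  by case.
move=> /andP[aS uS] hj hd.
have [aj azj] := hj a (mem_head _ _).
have [wa wzj wj wza wx] := conj_swap hz aj azj.
case: (hz) => zK zN.
set w := conj_by _ z in wa wzj wj wza wx *.
have hw : fpf_involution w by apply: conj_fpf.
have sub x : x \in S -> x \in a :: S by rewrite inE orbC => ->.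
have SE x : x \in S -> [/\ x <> a, x <> j, x <> z a & x <> z j].
  move=> xS; have [xj xzj] := hj x (sub x xS).
  split=> //; first by move=> xa; rewrite -xa xS in aS.
  by move=> h; apply: (hd a x (mem_head _ _) (sub x xS)).
have wS x : x \in S -> w x = z x by move=> /SE[*]; apply: wx.
have [||h1 h2 h3 h4] := IH w hw uS.
- by move=> x /SE[]; rewrite wj.
- by move=> x y xS yS; rewrite wS //; apply: hd; apply: sub.
have mapw S1 : {subset S1 <= S} -> map w S1 = map z S1.
  by move=> sub1; apply/eq_in_map => x /sub1 /wS.
split.
- move=> x; rewrite !inE !negb_or => /andP[/eqP xa xS] /andP[/eqP zxa zxS] xj xzj.
  have xza : x <> z a by move=> h; apply: zxa; rewrite h zK.
  have wxx : w x = z x by apply: wx.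
  by rewrite h1 ?wxx // wj.
- by rewrite h2 wj mapw.
- have zjS : z j \notin S by apply/negP => /SE[].
  have jS : j \notin S by apply/negP => /SE[].
  have [zNj zNa] := (zN j, zN a).
  rewrite h1 ?wzj ?wj //.
  by move=> h; apply: aj; rewrite -(zK a) -h zK.
case=> [|b S1] c S2 /=.
  case=> <- {c} <- {S2}; split; last by rewrite -{1}wj h3.
  have azS : z j \notin S by apply/negP => /SE[].
  have zNa := zN a.
  by rewrite h1 ?wa ?wj //; apply: nesym.
case=> <- {b} eS; have [e1 e2] := h4 _ _ _ eS.
have sub1 : {subset S1 <= S} by move=> x xS; rewrite eS mem_cat xS.
have cS : c \in S by rewrite eS mem_cat mem_head orbT.
rewrite -(wS c cS) e2 e1 wj mapw //.
Qed.

End Word.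

                                                                               
                                                                             
                                                                                  
(** * The covering condition, in either orientation of the integers *)

Definition blt (b : bool) (x y : nat) : bool := if b then (x < y)%N else (y < x)%N.

Ltac blia := unfold blt in *;
  match goal with b : bool |- _ => destruct b; lia end.

Lemma blt_trans b : transitive (blt b).
Proof. by move=> x y z; blia. Qed.

Lemma blt_irr b : irreflexive (blt b).
Proof. by move=> x; case: b; rewrite /blt ltnn. Qed.

                                                                               
                      
(** Pattern form of the cover relation: with [b] true for the covers to the left of an opener j,
    with [b] false for those to the right of a closer. The third clause excludes an arc at a that
    closes before j is reached. The fourth excludes a point lying between in both position and
    value. *)
Definition cover_cond (b : bool) (z : nat -> nat) (j a : nat) : Prop :=
  [/\ blt b a j, blt b (z a) (z j), ~ (blt b a (z a) /\ blt b (z a) j)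
    & forall e, blt b a e -> blt b e j -> blt b (z a) (z e) ->
        blt b (z e) (z j) -> False].

Section CondFacts.
Variables (b : bool) (z : nat -> nat) (j : nat).
Hypotheses (hz : fpf_involution z) (jk : blt b j (z j)).

Lemma fpf_inj : injective z.
Proof. exact: can_inj hz.1. Qed.

Lemma cover_cond_neq a : cover_cond b z j a -> [/\ a <> j, a <> z j, z a <> j, z a <> z j
  & (blt b (z a) a \/ blt b j (z a))].
Proof.
case=> aj ak h _; have zaa := hz.2 a.
have zaj : z a <> j by move=> e; have := hz.1 a; rewrite e => e2; move: jk; rewrite e2; blia.
by split=> //; move: jk; blia.
Qed.

(** Otherwise a' would be a forbidden intermediate point for a. *)
Lemma cover_cond_anti a a' : cover_cond b z j a -> cover_cond b z j a' -> blt b a a' ->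
  blt b (z a') (z a).
Proof.
move=> ca ca' aa'; case: ca' => a'j a'k _ _; case: ca => _ _ _ h.
have ne : z a <> z a' by move=> /fpf_inj e; move: aa'; rewrite e blt_irr.
have {}h := h a' aa' a'j.
by case lt: (blt b (z a) (z a')); [case: (h lt a'k) | blia].
Qed.

(** If the two ends of one arc both preceded j, the earlier end would violate the third clause. *)
Lemma cover_cond_disj a a' : cover_cond b z j a -> cover_cond b z j a' -> z a <> a'.
Proof.
move=> ca ca' e; have e2 := hz.1 a; rewrite e in e2.
have [_ _ _ _ h] := cover_cond_neq ca; case: ca' => a'j _ h' _; case: ca => aj _ _ _.
by apply: h'; rewrite e2; rewrite e in h; blia.
Qed.

End CondFacts.

Lemma sorted_last b (x : nat) S (a : nat) : sorted (blt b) S -> a \in S -> ~~ blt b (last x S) a.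
Proof.
elim/last_ind: S => // S y _; rewrite last_rcons.
rewrite -cats1 (sorted_pairwise (@blt_trans b)) pairwise_cat /= andbT.
move=> /andP[/allP h _]; rewrite mem_cat inE => /orP[/h|/eqP ->].
  by rewrite /= andbT; blia.
by rewrite blt_irr.
Qed.

Lemma sorted_head b (x : nat) S (a : nat) : sorted (blt b) S -> a \in S -> ~~ blt b a (head x S).
Proof.
case: S => // y S; rewrite (sorted_pairwise (@blt_trans b)) /=.
move=> /andP[/allP h _]; rewrite inE => /orP[/eqP ->|/h]; first by rewrite blt_irr.
by blia.
Qed.

Lemma sorted_mid b S1 (a : nat) S2 (x : nat) : sorted (blt b) (S1 ++ a :: S2) ->
  x \in S1 ++ a :: S2 -> [/\ (x \in S1) = blt b x a & (x \in S2) = blt b a x].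
Proof.
rewrite (sorted_pairwise (@blt_trans b)) pairwise_cat /=.
move=> /and4P[/allP h _ /allP h2 _] xS.
have i1 : x \in S1 -> blt b x a by move=> /h /= /andP[].
have i2 := h2 x; move: xS; rewrite mem_cat inE.
case: (x \in S1) i1 => [/(_ isT) i1|_]; case: (x \in S2) i2 => [/(_ isT) i2|_] /=;
  rewrite ?orbF ?orbT.
- by move=> _; split; blia.
- by move=> _; split; blia.
- by move=> _; split; blia.
by move=> /eqP->; rewrite blt_irr.
Qed.

Lemma mem_split (S : seq nat) (a : nat) : a \in S -> exists S1 S2 : seq nat, S = S1 ++ a :: S2.
Proof. by case/splitPr => S1 S2; exists S1, S2. Qed.

Section WordSpec.
Variables (b : bool) (z : nat -> nat) (j : nat) (S : seq nat).
Hypotheses (hz : fpf_involution z) (jk : blt b j (z j)).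
Hypotheses (sS : sorted (blt b) S) (cS : forall a : nat, a \in S -> cover_cond b z j a).
Local Notation w := (word j z S).
Local Notation k := (z j).

Let wP := wordP hz (sorted_uniq (@blt_trans b) (@blt_irr b) sS)
  (fun (a : nat) aS => let: And5 x y _ _ _ := cover_cond_neq hz jk (cS aS) in conj x y)
  (fun (a a' : nat) aS a'S => cover_cond_disj hz jk (cS aS) (cS a'S)).

Lemma word_out (x : nat) : x \notin S -> z x \notin S -> x <> j -> x <> k -> w x = z x.
Proof. by case: wP => h _ _ _; apply: h. Qed.

(** Letters and their partners run in opposite directions by [cover_cond_anti]. Hence a partner
    inherited from the neighbouring letter is extremal among those of all letters on that side. This
    lemma and the next three put [wordP] in the form needed for comparing values of a word. *)
Lemma word_j : (S = [::] /\ w j = k) \/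
  (exists2 a : nat, a \in S & w j = z a) /\ forall a : nat, a \in S -> ~~ blt b (z a) (w j).
Proof.
case: wP => _ -> _ _; case E: S => [|y S']; [by left | right].
have eE : last k (map z (y :: S')) = z (last y S') by rewrite /= last_map.
rewrite eE -{1}E; split; first by exists (last y S') => //; rewrite E mem_last.
move=> a; rewrite -E => aS; have lS : last y S' \in S by rewrite E mem_last.
have := @sorted_last b y _ _ sS aS; rewrite {1}E /= => lt.
case: (eqVneq a (last y S')) => [->|/eqP ne]; first by rewrite blt_irr.
have := cover_cond_anti hz jk (cS aS) (cS lS).
by blia.
Qed.

Lemma word_k : (S = [::] /\ w k = j) \/
  (w k \in S) /\ forall a : nat, a \in S -> ~~ blt b a (w k).
Proof.
case: wP => _ _ -> _; case E: S => [|y S']; [by left | right].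
rewrite /= mem_head; split=> // a; rewrite -E => aS.
by have := @sorted_head b y _ _ sS aS; rewrite {1}E.
Qed.

Lemma word_pos (a : nat) : a \in S ->
  (w a = k \/ exists2 a' : nat, a' \in S & blt b a' a /\ w a = z a') /\
  forall a' : nat, a' \in S -> blt b a' a -> ~~ blt b (z a') (w a).
Proof.
move=> aS; case: wP => _ _ _ h; have [S1 [S2 E]] := mem_split aS.
have [-> _] := h _ _ _ E; have mid := @sorted_mid b S1 a S2.
rewrite -E in mid.
split.
  case E1: S1 => [|y S'] /=; [by left | right].
  have lS : last y S' \in S1 by rewrite E1 mem_last.
  have lS' : last y S' \in S by rewrite E mem_cat lS.
  rewrite last_map; exists (last y S') => //; split=> //.
  by have [e _] := mid _ sS lS'; rewrite -e lS.
move=> a' a'S lt; have [e _] := mid _ sS a'S; rewrite lt in e.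
move: sS; rewrite E (sorted_pairwise (@blt_trans b)) pairwise_cat.
move=> /and3P[_ sS1 _]; rewrite -(sorted_pairwise (@blt_trans b)) in sS1.
have a'S1 : a' \in S1 by rewrite e.
clear e; case E1: S1 => [|y S']; first by rewrite E1 in a'S1.
 rewrite /= last_map.
have lS : last y S' \in S by rewrite E mem_cat E1 mem_last.
have := @sorted_last b y _ _ sS1 a'S1; rewrite {1}E1 /= => lt2.
case: (eqVneq a' (last y S')) => [->|/eqP ne]; first by rewrite blt_irr.
by have := cover_cond_anti hz jk (cS a'S) (cS lS); blia.
Qed.

Lemma word_val (a : nat) : a \in S ->
  (w (z a) = j \/ w (z a) \in S /\ blt b a (w (z a))) /\
  forall a' : nat, a' \in S -> blt b a a' -> ~~ blt b a' (w (z a)).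
Proof.
move=> aS; case: wP => _ _ _ h; have [S1 [S2 E]] := mem_split aS.
have [_ ->] := h _ _ _ E; have mid := @sorted_mid b S1 a S2.
rewrite -E in mid.
split.
  case E2: S2 => [|y S'] /=; [by left | right].
  have yS : y \in S by rewrite E mem_cat inE E2 mem_head !orbT.
  by split=> //; have [_ e] := mid _ sS yS; rewrite -e E2 mem_head.
move=> a' a'S lt; have [_ e] := mid _ sS a'S; rewrite lt in e.
move: sS; rewrite E (sorted_pairwise (@blt_trans b)) pairwise_cat /=.
move=> /and4P[_ _ _ sS2]; rewrite -(sorted_pairwise (@blt_trans b)) in sS2.
exact: sorted_head.
Qed.

End WordSpec.

                                            

(** * Weighted sums over the subwords of a list of letters *)

Section ChainSum.
Variables (K : comNzRingType) (M : lmodType K) (t : K).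
Implicit Types (F H : (nat -> nat) -> M) (A S : seq nat) (z : nat -> nat).

(** The expansion of the operators 1 + t u_{aj}, applied from left to right: the sum over subwords S
    of A of t to the power |S| times F at [word j z S]. [F] is arbitrary, so F can be replaced
    termwise by its image under a divided difference. *)
Fixpoint chain_sum F (j : nat) A z : M :=
  if A is a :: A' then
    chain_sum F j A' z + t *: chain_sum F j A' (conj_by (transp a j) z)
  else F z.

Lemma chain_sum_cat F j A1 A2 z :
  chain_sum F j (A1 ++ A2) z = chain_sum (chain_sum F j A2) j A1 z.
Proof. by elim: A1 z => //= a A IH z; rewrite !IH. Qed.

Lemma eq_chain_sum F H j A z :
  (forall S, subseq S A -> F (word j z S) = H (word j z S)) ->
  chain_sum F j A z = chain_sum H j A z.
Proof.
elim: A z => [|a A IH] z h /=; first exact: (h [::]).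
rewrite !IH // => S sub.
  by apply: (h (a :: S)); rewrite /= eqxx.
by apply: h; apply: subseq_trans sub (subseq_cons _ _).
Qed.

Lemma chain_sumD F H j A z :
  chain_sum (fun w => F w + t *: H w) j A z =
  chain_sum F j A z + t *: chain_sum H j A z.
Proof.
elim: A z => //= a A IH z; rewrite !IH !scalerDr !addrA; congr (_ + _).
by rewrite -!addrA; congr (_ + _); rewrite addrC.
Qed.

Lemma chain_sum_conj F j p q A z :
  chain_sum (fun w => F (conj_by (transp p q) w)) j A z =
  chain_sum F (transp p q j) (map (transp p q) A) (conj_by (transp p q) z).
Proof. by elim: A z => //= a A IH z; rewrite !IH conj_by_conj. Qed.

Lemma chain_sum_filter F j (P : pred nat) A z :
  (forall S, subseq S A -> ~~ all P S -> F (word j z S) = 0) ->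
  chain_sum F j A z = chain_sum F j (filter P A) z.
Proof.
elim: A z => //= a A IH z h.
have hA S : subseq S A -> subseq S (a :: A).
  by move=> sub; apply: subseq_trans sub (subseq_cons _ _).
rewrite IH => [|S /hA]; last exact: h.
case: ifP => Pa /=.
  rewrite IH // => S sub nP; apply: (h (a :: S)); first by rewrite /= eqxx.
  by rewrite /= Pa.
rewrite [X in t *: X](@eq_chain_sum _ (fun=> 0)).
  have -> : forall w, chain_sum (fun=> 0) j A w = 0.
    by elim: A {IH h hA} => //= c A IH w; rewrite !IH scaler0 addr0.
  by rewrite scaler0 addr0.
by move=> S sub; apply: (h (a :: S)); rewrite /= ?eqxx ?Pa.
Qed.

                                                                               
                         
(** Only the choices made at the consecutive letters x, y matter. Using neither, g alone, or both
    gives the conjugated term. Using f alone gives -t F, with total weight -t^2, and it cancels the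
    choice of both letters, of weight t^2, since conjugation sends that word to the one with f
    alone. The choices left are none and g, and conjugation turns g into y. *)
Lemma chain_sum_cancel D F j p q A1 A2 x y f g z :
  (f = x /\ g = y \/ f = y /\ g = x) ->
  transp p q j = j -> transp p q g = y ->
  map (transp p q) A1 = A1 -> map (transp p q) A2 = A2 ->
  (forall S1 S0 S2, subseq S1 A1 -> S0 \in [:: [::]; [:: g]; [:: x; y]] ->
     subseq S2 A2 -> let w := word j z (S1 ++ S0 ++ S2) in
     D w = F (conj_by (transp p q) w)) ->
  (forall S1 S2, subseq S1 A1 -> subseq S2 A2 ->
     let w := word j z (S1 ++ f :: S2) in D w = - t *: F w) ->
  (forall S1, subseq S1 A1 -> conj_by (transp p q) (word j z (S1 ++ [:: x; y]))
     = word j z (S1 ++ [:: f])) ->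
  chain_sum D j (A1 ++ x :: y :: A2) z =
  chain_sum F j (A1 ++ y :: A2) (conj_by (transp p q) z).
Proof.
move=> fg sj sg sA1 sA2 hnf hf hc; rewrite !chain_sum_cat.
have -> : chain_sum (chain_sum F j (y :: A2)) j A1 (conj_by (transp p q) z) =
    chain_sum (fun w => chain_sum F j (y :: A2) (conj_by (transp p q) w)) j A1 z.
  by rewrite chain_sum_conj sj sA1.
apply: eq_chain_sum => S1 sub1.
set u := word j z S1.
have Dsame S0 : S0 \in [:: [::]; [:: g]; [:: x; y]] ->
    chain_sum D j A2 (word j u S0) =
    chain_sum F j A2 (conj_by (transp p q) (word j u S0)).
  move=> S0in; have -> w : chain_sum F j A2 (conj_by (transp p q) w) =
      chain_sum (fun w => F (conj_by (transp p q) w)) j A2 w.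
    by rewrite chain_sum_conj sj sA2.
  by apply: eq_chain_sum => S2 sub2; rewrite -!word_cat -?catA hnf.
have Df : chain_sum D j A2 (word j u [:: f]) =
    - t *: chain_sum F j A2 (word j u [:: f]).
  (* Writing the summand as 0 + t (-F) lets [chain_sumD] pull the scalar out of the sum. *)
  transitivity (0 *: chain_sum F j A2 (word j u [:: f]) +
    chain_sum (fun w => 0 + t *: (-1 *: F w)) j A2 (word j u [:: f])).
    rewrite scale0r add0r; apply: eq_chain_sum => S2 sub2.
    by rewrite -!word_cat -?catA hf // add0r scalerA mulrN1.
  rewrite chain_sumD scale0r add0r.
  have -> : forall w, chain_sum (fun=> 0) j A2 w = 0.
    by elim: A2 {sA2 hnf hf Dsame} => //= c A IH w; rewrite !IH scaler0 addr0.
  have -> : forall w, chain_sum (fun w => -1 *: F w) j A2 w =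
      - chain_sum F j A2 w.
    elim: A2 {sA2 hnf hf Dsame} => /= [|c A IH] w; first by rewrite scaleN1r.
    by rewrite !IH opprD scalerN.
  by rewrite add0r scalerN scaleNr.
have e0 := Dsame [::] isT.
have eg : chain_sum D j A2 (word j u [:: g]) =
    chain_sum F j A2 (conj_by (transp p q) (word j u [:: g])).
  by apply: Dsame; rewrite !inE eqxx orbT.
have exy : chain_sum D j A2 (word j u [:: x; y]) =
    chain_sum F j A2 (conj_by (transp p q) (word j u [:: x; y])).
  by apply: Dsame; rewrite !inE eqxx !orbT.
rewrite -!word_cat -/u hc // !word_cat -/u in exy.
have egc : conj_by (transp p q) (word j u [:: g]) =
    conj_by (transp y j) (conj_by (transp p q) u).
  by rewrite /= conj_by_conj sj sg.
rewrite egc in eg; rewrite /= in e0 eg exy Df *.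
case: fg => -[? ?]; subst f g; rewrite e0 eg Df exy.
  by rewrite scaleNr addNr scaler0 addr0.
by rewrite scalerDr scaleNr scalerN addrACA addNr addr0.
Qed.
End ChainSum.

(** * Effect of exchanging adjacent points p, q on covers and on descents *)

Definition adjacent (b : bool) (p q : nat) : Prop := if b then q = p.+1 else p = q.+1.

Ltac alia := unfold adjacent, blt in *;
  match goal with b : bool |- _ => destruct b; lia end.

(** No integer lies strictly between p and q, so the exchange can reverse only the comparison of p
    with q. *)
Lemma blt_transp b p q x y : adjacent b p q ->
  blt b (transp p q x) (transp p q y) =
  blt b x y && ~~ ((x == p) && (y == q)) || (x == q) && (y == p).
Proof.
move=> pq; have ne : p <> q by alia.
have E w : [\/ w = p /\ transp p q w = q, w = q /\ transp p q w = p
    | [/\ w <> p, w <> q & transp p q w = w]].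
  case: (eqVneq w p) => [->|/eqP wp]; first by constructor 1; rewrite transpL.
  case: (eqVneq w q) => [->|/eqP wq]; first by constructor 2; rewrite transpR.
  by constructor 3; rewrite transpN.
by case: (E x) => [[e1 ->]|[e1 ->]|[e1 e1' ->]];
   case: (E y) => [[e2 ->]|[e2 ->]|[e2 e2' ->]]; alia.
Qed.

Section CondConj.
Variables (b : bool) (z : nat -> nat) (j p q : nat).
Hypotheses (hz : fpf_involution z) (jk : blt b j (z j)) (pq : adjacent b p q).
Hypotheses (des : blt b (z q) (z p)) (zqp : z q <> p).
Local Notation s := (transp p q).
Local Notation z' := (conj_by s z).

Lemma invol_eq x y : [/\ x = y -> z x = z y, z x = z y -> x = y,
  z x = y -> x = z y & x = z y -> z x = y].
Proof.
case: (hz) => zK _; split; [by move-> | | by move<- | by move->].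
by move=> e; rewrite -(zK x) e zK.
Qed.

Lemma zpq : z p <> q.
Proof. by case: (invol_eq p q) => _ _ h _ /h /esym. Qed.

Lemma cover_cond_conj a : cover_cond b z' (s j) (s a) <->
  [/\ blt b (s a) (s j), blt b (s (z a)) (s (z j)),
      ~ (blt b (s a) (s (z a)) /\ blt b (s (z a)) (s j))
    & forall e, blt b (s a) (s e) -> blt b (s e) (s j) ->
        blt b (s (z a)) (s (z e)) -> blt b (s (z e)) (s (z j)) -> False].
Proof.
have E x : z' (s x) = s (z x) by rewrite /conj_by /= transpK.
split=> -[h1 h2 h3 h4]; split; rewrite ?E // in h1 h2 h3 h4 *.
  by move=> e; have := h4 (s e); rewrite E.
by move=> e; rewrite -(transpK p q e) E; apply: h4.
Qed.

Lemma ord_pos x y : blt b (z x) (z y) -> x = p -> y <> q.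
Proof. by move=> h ? ?; subst x y; clear - h des; alia. Qed.

Lemma ord_val x y : blt b x y -> z x = p -> z y <> q.
Proof.
move=> h hx hy; have := des; rewrite -hx -hy !hz.1.
by clear - h; alia.
Qed.

(** A point blocking p would also block q, unless it were q itself, whose value precedes that of
    p. *)
Lemma cover_cond_p : cover_cond b z j q -> blt b (z p) (z j) -> cover_cond b z j p.
Proof.
move=> [qj _ h3 h4] pk; split=> //; first by alia.
  move=> [h5 h6]; have := h4 (z p); rewrite hz.1.
  have := zpq; have := hz.2 q; have := invol_eq p q.
  by move=> [*]; alia.
move=> e pe ej pe' ek; have := h4 e; have := invol_eq e q.
by move=> [*]; alia.
Qed.

Lemma cover_cond_zp : cover_cond b z j (z q) -> blt b (z p) j -> cover_cond b z j (z p).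
Proof.
move=> [qj]; rewrite /cover_cond !hz.1 => qk h3 h4 pj; have npq := zpq; split=> //.
- by have := h4 (z p); rewrite hz.1; alia.
- by move=> [h5 h6]; have := invol_eq q j; have := hz.2 q; move=> ? [*]; alia.
move=> e pe ej pe' ek; have := h4 e; have := invol_eq e p; have := invol_eq e q.
by move=> [? ? ? ?] [*]; alia.
Qed.

                                                                              
                                                                             
(** By [blt_transp], a cover can be lost only when the reversed comparison creates a blocking point.
    If p and q are both covers, the letter q moves to p and the old p, now at q, blocks it. The same
    happens in the values when z p and z q are both covers. No cover is gained, because the descent
    at p, q rules out the opposite reversal. *)
Lemma cover_cond_conj_away a : j <> p -> z j <> p ->
  cover_cond b z' (s j) (s a) <-> [/\ cover_cond b z j a, ~ (a = q /\ cover_cond b z j p)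
    & ~ (a = z q /\ cover_cond b z j (z p))].
Proof.
move=> jp kp; have npq := zpq; have zaa := hz.2 a.
have f1 : a = p -> z a <> q by move=> ->.
have f2 : a = q -> z a <> p by move=> ->.
rewrite cover_cond_conj; split; last first.
  case=> ca nq nzq; have [aj ak h3 h4] := ca; split; rewrite ?blt_transp //.
  - by have := ord_pos ak; clear - aj pq; alia.
  - by have := ord_val aj; clear - ak pq; alia.
  - by clear - h3 f1 f2 jp pq; alia.
  move=> e; rewrite !blt_transp // => e1 e2 e3 e4; have := h4 e.
  case: (boolP ((a == q) && (e == p))) => [/andP[/eqP ? /eqP ?]|n1].
    subst a e; case: nq; split=> //; apply: cover_cond_p => //.
    by have := hz.2 p; clear - e3 e4 pq kp; alia.
  case: (boolP ((z a == q) && (z e == p))) => [/andP[/eqP a1 /eqP a2]|n2].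
    have aE : a = z q by rewrite -a1 hz.1.
    have eE : e = z p by rewrite -a2 hz.1.
    subst a e; case: nzq; split=> //; apply: cover_cond_zp => //.
    by clear - e1 e2 pq jp; alia.
  by clear - e1 e2 e3 e4 n1 n2 jp kp pq; alia.
case; rewrite !blt_transp // => c1 c2 c3 c4.
have aj : blt b a j by clear - c1 jp pq; alia.
have ca : cover_cond b z j a.
  split=> //; [by clear -c2 kp pq; alia | |].
    have : z a = p -> j <> q.
      move=> h1 h2; have := des; rewrite -h2 -h1 hz.1.
      by clear - aj jk; alia.
    by clear - c3 f1 f2 pq; alia.
  move=> e e1 e2 e3 e4; have := c4 e; rewrite !blt_transp //.
  have := ord_pos e3; have := ord_pos e4; have := ord_val e1; have := ord_val e2.
  by clear - e1 e2 e3 e4 pq; alia.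
split=> //.
  move=> [ea [d1 d2 _ _]]; subst a; have := c4 p; rewrite !blt_transp //.
  by have := hz.2 p; clear -d1 d2 pq jp des zqp aj; alia.
move=> [ea]; rewrite /cover_cond hz.1 => -[d1 d2 _ _]; subst a.
have kq : z j <> q by move=> h; rewrite -h hz.1 blt_irr in aj.
have := c4 (z p); rewrite !blt_transp // !hz.1.
by have := hz.2 p; clear - aj d1 d2 kq des zqp pq; alia.
Qed.

End CondConj.

(** Either conjugation replaces the arcs {p, z p} and {q, z q} by {p, z q} and {q, z p}. *)
Lemma conj_arcs z p q : fpf_involution z -> z p <> q ->
  conj_by (transp (z p) (z q)) z = conj_by (transp p q) z.
Proof.
move=> [zK zN] pq; have inj := can_inj zK.
have zt a b x : z (transp a b x) = transp (z a) (z b) (z x).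
  by rewrite /transp !(inj_eq inj); case: ifP => // _; case: ifP.
apply/funext => x; rewrite /conj_by /= !zt !zK.
have zqp : z q <> p by move=> h; apply: pq; rewrite -h zK.
rewrite [LHS]transp_transp.
have -> : transp (z p) (z q) p = p by apply: transpN; apply: nesym.
by have -> : transp (z p) (z q) q = q by apply: transpN; apply: nesym.
Qed.

Lemma sorted_split b (I : seq nat) (x y : nat) : sorted (blt b) I ->
  x \in I -> y \in I -> blt b x y ->
  (forall e, e \in I -> blt b x e -> blt b e y -> False) ->
  exists A1 A2 : seq nat, I = A1 ++ x :: y :: A2.
Proof.
move=> sI xI yI xy hb; have [A1 [S2 E]] := mem_split xI.
have := sI; rewrite E => /sorted_mid mid; rewrite -E in mid.
have [_ y2] := mid y yI; rewrite xy in y2.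
case: S2 => [|c S2] // in E mid y2 *.
suff -> : y = c by exists A1, S2.
have cI : c \in I by rewrite E mem_cat !inE eqxx !orbT.
have [_ xc] := mid c cI; rewrite mem_head in xc.
move: sI; rewrite E (sorted_pairwise (@blt_trans b)) pairwise_cat => /and3P[_ _].
rewrite -(sorted_pairwise (@blt_trans b)) => /path_sorted sS.
have := sorted_head x sS y2; rewrite /= => yc.
have := hb c cI (esym xc); move: yc; clear; move=> yc h.
by case E: (blt b c y); [case: (h E) | clear h; blia].
Qed.

Section NoFlip.
Variables (b : bool) (z : nat -> nat) (j p q : nat) (S : seq nat).
Hypotheses (hz : fpf_involution z) (jk : blt b j (z j)) (pq : adjacent b p q).
Hypotheses (des : blt b (z q) (z p)) (zqp : z q <> p).
Hypotheses (sS : sorted (blt b) S) (cS : forall a : nat, a \in S -> cover_cond b z j a).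
Hypotheses (jp : j <> p) (kp : z j <> p).
Local Notation w := (word j z S).

(** As a letter, p inherits z j or the partner of an earlier letter. If instead z p is a letter,
    then p is joined to the next letter or to j. All of these come after z p. *)
Lemma word_p : if (p \in S) || (z p \in S) then blt b (z p) (w p) else w p == z p.
Proof.
case: (boolP (p \in S)) => [pS|pS] /=.
  have [[->|[a' a'S [lt ->]]] _] := word_pos hz jk sS cS pS.
    by case: (cS pS).
  by apply: (cover_cond_anti hz jk (cS a'S) (cS pS)).
case: (boolP (z p \in S)) => [zpS|zpS].
  have [h _] := word_val hz jk sS cS zpS; rewrite hz.1 in h.
  by case: h => [->|[]//]; case: (cS zpS).
by apply/eqP/(word_out hz jk sS cS) => //; apply: nesym.
Qed.

Lemma word_p_ge : ~~ blt b (w p) (z p).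
Proof. by have := word_p; case: ifP => _; clear; [|move/eqP]; blia. Qed.

(** The value at p never moves before z p, so only a growing value at q could destroy the descent.
    If q is a letter, its new value does not pass z p when p is an earlier letter. When p is not a
    cover, it does not pass z j, which then precedes z p. The case where z q is a letter is the same
    with positions and values exchanged. *)
Lemma no_flip : (q \in S -> cover_cond b z j p -> p \in S) ->
  (z q \in S -> cover_cond b z j (z p) -> z p \in S) ->
  blt b (w q) (w p) && (w q != p).
Proof.
move=> hP hV; have wp := word_p_ge; have npq := zpq hz zqp.
case: (eqVneq q j) => [qj|/eqP qj].
  have des2 := des; rewrite qj in des2; rewrite qj; have [[_ ->]|[[a aS ->] _]] := word_j hz jk sS cS.
    by apply/andP; split; [clear -wp des2; blia | exact/eqP].
  have [aj ak _ _] := cS aS.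
  apply/andP; split; first by clear -wp des2 ak; blia.
  by apply/eqP => e; move: des2; rewrite -e hz.1; clear -aj jk; blia.
case: (eqVneq q (z j)) => [qk|/eqP qk].
  have des2 := des; rewrite qk hz.1 in des2.
  rewrite qk; have [[_ ->]|[kS _]] := word_k hz jk sS cS.
    by apply/andP; split; [clear -wp des2; blia | exact/eqP].
  have [aj ak _ _] := cS kS.
  apply/andP; split; first by clear -wp des2 aj; blia.
  by apply/eqP => e; move: aj; rewrite e; clear -jk pq jp qk; alia.
case: (boolP (q \in S)) => qS.
  have [qj' qk' _ h4] := cS qS; have [hq hq2] := word_pos hz jk sS cS qS.
  case pk: (blt b (z p) (z j)).
    have cp : cover_cond b z j p by apply: cover_cond_p (cS qS) pk.
    have pS := hP qS cp; have := word_p; rewrite pS /= => wp'.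
    have := hq2 _ pS; have -> : blt b p q by clear -pq; alia.
    move=> /(_ isT) wq; apply/andP; split; first by clear -wq wp'; blia.
    apply/eqP; case: hq => [->//|[a aS [_ ->]]] e.
    by apply: (cover_cond_disj hz jk (cS aS) cp).
  apply/andP; split.
    case: hq => [->|[a aS [_ ->]]].
      have : z p <> z j by move/(fpf_inj hz)/esym.
      by clear - pk wp; blia.
    by have [_ ak _ _] := cS aS; clear - ak pk wp; blia.
  apply/eqP; case: hq => [->//|[a aS [_ ->]]] e.
  have [aj _ _ _] := cS aS; move: pk; rewrite -e hz.1.
  by clear -aj jk; blia.
case: (boolP (z q \in S)) => zqS.
  have [qj' qk' _ h4] := cS zqS; have := word_val hz jk sS cS zqS.
  rewrite hz.1 => -[hq hq2].
  case pj: (blt b (z p) j).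
    have cp : cover_cond b z j (z p) by apply: cover_cond_zp (cS zqS) pj.
    have pS := hV zqS cp; have := word_p; rewrite pS orbT => wp'.
    have := hq2 _ pS des => wq; apply/andP; split; first by clear -wq wp'; blia.
    apply/eqP; case: hq => [->//|[wqS _]] e; rewrite e in wqS.
    by apply: (cover_cond_disj hz jk cp (cS wqS)); rewrite hz.1.
  have zpj : z p <> j by move=> h; apply: kp; rewrite -h hz.1.
  apply/andP; split.
    case: hq => [->|[wqS _]]; first by clear - pj zpj wp; blia.
    by have [aj _ _ _] := cS wqS; clear - aj pj wp; blia.
  apply/eqP; case: hq => [->//|[wqS _]] e; rewrite e in wqS.
  have [aj _ _ _] := cS wqS.
  have := word_p; rewrite wqS /= => wp'.
  have [[e1|[a aS [_ e1]]] _] := word_pos hz jk sS cS wqS.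
    have wK := (word_fpf j S hz).1 q; rewrite e e1 in wK.
    by move: qk; rewrite wK.
  have wK := (word_fpf j S hz).1 q; rewrite e in wK; rewrite wK in wp'.
  by clear - wp' pj zpj aj pq qj; alia.
rewrite (word_out hz jk sS cS qS zqS qj qk).
by apply/andP; split; [clear - wp des; blia | apply/eqP].
Qed.

(** Here p keeps its value z p, while q inherits z j or the partner of a letter before p, and these
    come after z p. *)
Lemma flip_pos : q \in S -> p \notin S -> cover_cond b z j p -> blt b (w p) (w q).
Proof.
move=> qS pS cp; have := word_p; rewrite (negPf pS) /=.
case: (boolP (z p \in S)) => [zpS|zpS] /=.
  by case: (cover_cond_disj hz jk (cS zpS) cp); rewrite hz.1.
move=> /eqP ->; have [[->|[a aS [lt ->]]] _] := word_pos hz jk sS cS qS.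
  by case: cp.
apply: (cover_cond_anti hz jk (cS aS) cp).
have : a <> p by move=> e; rewrite -e aS in pS.
by clear - lt pq; alia.
Qed.

Lemma flip_val : z q \in S -> z p \notin S -> cover_cond b z j (z p) -> blt b (w p) (w q).
Proof.
move=> qS zpS cp; have := word_p.
case: (boolP (p \in S)) => [pS|pS] /=.
  by case: (cover_cond_disj hz jk cp (cS pS)); rewrite hz.1.
rewrite (negPf zpS) => /eqP ->; have [+ _] := word_val hz jk sS cS qS.
rewrite hz.1 => -[->|[wS lt]]; first by case: cp.
have ne : w q <> z p by move=> e; rewrite -e wS in zpS.
case E: (blt b (z p) (w q)) => //.
have lt2 : blt b (w q) (z p) by clear -ne E; blia.
have h1 := cover_cond_anti hz jk (cS qS) (cS wS) lt.
have h2 := cover_cond_anti hz jk (cS wS) cp lt2.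
by rewrite hz.1 in h1; rewrite hz.1 in h2; clear - h1 h2 pq; alia.
Qed.
End NoFlip.

Lemma sorted_eq_mem b (s1 s2 : seq nat) : sorted (blt b) s1 -> sorted (blt b) s2 ->
  (forall x, x \in s1 <-> x \in s2) -> s1 = s2.
Proof.
move=> h1 h2 h; apply: (irr_sorted_eq (@blt_trans b) (@blt_irr b)) => // x.
by apply/idP/idP => /h.
Qed.

                                               

(** * Divided differences applied along a whole chain *)

Section Transition.
Variables (K : comNzRingType) (M : lmodType K) (t : K) (F : (nat -> nat) -> M).
Variables (b : bool) (z : nat -> nat) (j p q : nat).
Hypotheses (hz : fpf_involution z) (jk : blt b j (z j)) (pq : adjacent b p q).
Hypotheses (des : blt b (z q) (z p)) (zqp : z q <> p).
Variables I I' : seq nat.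
Hypotheses (sI : sorted (blt b) I) (hI : forall a : nat, a \in I <-> cover_cond b z j a).
Local Notation s := (transp p q).
Local Notation z' := (conj_by s z).
Hypotheses (sI' : sorted (blt b) I')
  (hI' : forall a : nat, a \in I' <-> cover_cond b z' (s j) a).

                                                                               
                                        
(** What the beta divided difference does to the polynomial indexed by w, expressed on the indices
    alone. [bdivdiff_demazure] justifies it for the symplectic Grothendieck polynomials. *)
Definition demazure (w : nat -> nat) : M :=
  if blt b (w q) (w p) && (w q != p) then F (conj_by s w) else - t *: F w.

Let condI S : subseq S I -> forall a : nat, a \in S -> cover_cond b z j a.
Proof. by move=> sub a /(mem_subseq sub) /hI. Qed.

Let sortS S : subseq S I -> sorted (blt b) S.
Proof. by move=> sub; apply: subseq_sorted sub sI; apply: blt_trans. Qed.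

Lemma demazure_asc w : blt b (w p) (w q) -> demazure w = - t *: F w.
Proof.
move=> h; rewrite /demazure; case E: (blt b (w q) (w p)) => //.
by move: h E; clear; blia.
Qed.

Lemma demazure_des w : blt b (w q) (w p) && (w q != p) ->
  demazure w = F (conj_by s w).
Proof. by rewrite /demazure => ->. Qed.

Let mapid (A : seq nat) : p \notin A -> q \notin A -> map s A = A.
Proof.
move=> pA qA; rewrite -[RHS]map_id; apply/eq_in_map => x xA; apply: transpN.
  by move=> e; rewrite -e xA in pA.
by move=> e; rewrite -e xA in qA.
Qed.

Lemma demazure_nondescent w : ~~ (blt b (w q) (w p) && (w q != p)) ->
  demazure w = - t *: F w.
Proof. by rewrite /demazure => /negPf->. Qed.

Section Away.
Hypotheses (jp : j <> p) (kp : z j <> p).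

Let cI' a : a \in I' <-> [/\ cover_cond b z j (s a), ~ (s a = q /\ cover_cond b z j p)
    & ~ (s a = z q /\ cover_cond b z j (z p))].
Proof. by rewrite hI' -{1}(transpK p q a); apply: cover_cond_conj_away. Qed.

(** No cover is lost and every word keeps its descent by [no_flip], so the two sums agree term by
    term after relabelling. *)
Lemma transition_noflip : ~ (cover_cond b z j p /\ cover_cond b z j q) ->
  ~ (cover_cond b z j (z p) /\ cover_cond b z j (z q)) ->
  chain_sum t demazure j I z = chain_sum t F (s j) I' z'.
Proof.
move=> nP nV; have -> : I' = map s I.
  apply: (@sorted_eq_mem b) => //.
    apply: (@homo_sorted_in _ _ (mem I) s (blt b) (blt b)) => //.
    move=> x y /hI cx /hI cy lt; rewrite blt_transp // lt /=.
    by case: eqP => // ex; case: eqP => // ey; subst x y; case: nP.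
  move=> x; rewrite cI'; split.
    case=> c _ _; apply/mapP; exists (s x); rewrite ?transpK //; exact/hI.
  move=> /mapP[y /hI cy ->]; rewrite transpK; split=> //.
    by case=> e c; apply: nP; rewrite -e.
  by case=> e c; apply: nV; rewrite -e.
rewrite -chain_sum_conj; apply: eq_chain_sum => S sub.
apply: demazure_des; apply: no_flip => //; [exact: sortS | exact: condI | |].
  by move=> qS c; case: nP; split=> //; apply: condI qS.
by move=> qS c; case: nV; split=> //; apply: condI qS.
Qed.

Lemma transition_flip_pos : cover_cond b z j p -> cover_cond b z j q ->
  chain_sum t demazure j I z = chain_sum t F (s j) I' z'.
Proof.
move=> cp cq; have [pI qI] : p \in I /\ q \in I by split; apply/hI.
have pq' : blt b p q by clear -pq; alia.
have [|A1 [A2 E]] := sorted_split sI pI qI pq'.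
  by move=> e _ h1 h2; move: pq h1 h2; clear; alia.
have jq : j <> q by move=> h; case: cq; rewrite h blt_irr.
have sj : s j = j by apply: transpN.
have uI := sorted_uniq (@blt_trans b) (@blt_irr b) sI.
have [pA1 qA1 pA2 qA2] : [/\ p \notin A1, q \notin A1, p \notin A2 & q \notin A2].
  move: uI; rewrite E cat_uniq /= !inE !negb_or.
  by case/and3P=> _ /and3P[? ? _] /and3P[/andP[_ ?] ? _].
have pnq : p <> q by clear -pq'; move=> e; rewrite e blt_irr in pq'.
have memI' x : x \in A1 ++ q :: A2 <-> x \in I /\ x <> p.
  rewrite E !mem_cat !inE; case: (eqVneq x p) => [->|/eqP ne] /=.
    by rewrite (negPf pA1) (negPf pA2) orbF /=; split=> [/eqP|[]].
  by split=> [->|[]].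
have -> : I' = A1 ++ q :: A2.
  apply: (@sorted_eq_mem b) => //.
    apply: subseq_sorted sI; first exact: blt_trans.
    by rewrite E cat_subseq // subseq_cons.
  move=> x; rewrite cI' memI' hI; split.
    case=> c n1 _; case: (eqVneq x p) => [xp|/eqP xp].
      by case: n1; rewrite xp transpL.
    case: (eqVneq x q) => [->|/eqP xq]; first by split=> //; apply: nesym.
    by rewrite (transpN xp xq) in c.
  case=> cx xp; case: (eqVneq x q) => [->|/eqP xq].
    rewrite transpR; split=> //; first by case.
    by case=> e _; apply: (cover_cond_disj hz jk cq cp).
  rewrite transpN //; split=> //; first by case.
  by case=> e _; apply: (cover_cond_disj hz jk cq cx).
(* The letters p, q are consecutive in I. The exceptional choice is q without p, which destroys the
   descent by [flip_pos]. *)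
rewrite sj E; apply: (@chain_sum_cancel _ _ t demazure F j p q A1 A2 p q q p) => //.
- by right.
- by rewrite transpL.
- exact: mapid.
- exact: mapid.
- move=> S1 S0 S2 sub1 S0in sub2.
  have sub : subseq (S1 ++ S0 ++ S2) I.
    rewrite E (_ : p :: q :: A2 = [:: p; q] ++ A2) // !cat_subseq //.
    move: S0in; rewrite !inE => /or3P[] /eqP-> //=; rewrite ?eqxx //.
  apply: demazure_des; apply: no_flip => //; [exact: sortS | exact: condI | |].
    move: S0in; rewrite !mem_cat !inE => /or3P[] /eqP->; rewrite !inE ?eqxx ?orbT //.
    by move/negP: qA1 => qA1; move/negP: qA2 => qA2 /orP[/(mem_subseq sub1)|/(mem_subseq sub2)].
  by move=> /(condI sub) c; case: (cover_cond_disj hz jk cq c).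
- move=> S1 S2 sub1 sub2; have sub : subseq (S1 ++ q :: S2) I.
    rewrite E cat_subseq //; apply: subseq_trans (subseq_cons _ p).
    by rewrite /= eqxx.
  apply: demazure_asc; apply: flip_pos => //; [exact: sortS|exact: condI| |].
    by rewrite mem_cat mem_head orbT.
  rewrite mem_cat inE !negb_or; apply/and3P; split.
  + by apply: contra pA1; apply: mem_subseq.
  + exact/eqP.
  by apply: contra pA2; apply: mem_subseq.
move=> S1 sub1; rewrite !word_cat /= (conj_by_conj q j p j) transpR.
by rewrite (@transpN q j p) ?conj_byK //; apply: nesym.
Qed.

Lemma transition_flip_val : cover_cond b z j (z p) -> cover_cond b z j (z q) ->
  chain_sum t demazure j I z = chain_sum t F (s j) I' z'.
Proof.
move=> cp cq; have [pI qI] : z p \in I /\ z q \in I by split; apply/hI.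
have pq' : blt b p q by clear -pq; alia.
have [|A1 [A2 E]] := sorted_split sI qI pI des.
  move=> e /hI ce h1 h2; have := cover_cond_anti hz jk ce cp h2.
  have := cover_cond_anti hz jk cq ce h1; rewrite !hz.1.
  by move: pq; clear; alia.
have npq := zpq hz zqp.
have pNI x : x \in I -> x <> p.
  by move=> /hI cx e; apply: (cover_cond_disj hz jk cp cx); rewrite hz.1.
have qNI x : x \in I -> x <> q.
  by move=> /hI cx e; apply: (cover_cond_disj hz jk cq cx); rewrite hz.1.
have jq : j <> q.
  by move=> h; case: cq => + _ _ _; rewrite -h; move: jk; clear; blia.
have sj : s j = j by apply: transpN.
have uI := sorted_uniq (@blt_trans b) (@blt_irr b) sI.
have [pA1 qA1 pA2 qA2] : [/\ z p \notin A1, z q \notin A1, z p \notin A2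
    & z q \notin A2].
  move: uI; rewrite E cat_uniq /= !inE !negb_or.
  by case/and3P=> _ /and3P[? ? _] /and3P[/andP[_ ?] ? _].
have pnq : z q <> z p by move=> e; move: des; rewrite e blt_irr.
have subI S : {subset S <= I} -> map s S = S.
  by move=> sub; apply: mapid; apply/negP => /sub; [move/pNI | move/qNI].
have memI' x : x \in A1 ++ z p :: A2 <-> x \in I /\ x <> z q.
  rewrite E !mem_cat !inE; case: (eqVneq x (z q)) => [->|/eqP ne] /=.
    by rewrite (negPf qA1) (negPf qA2) orbF /=; split=> [/eqP|[]].
  by split=> [->|[]].
have -> : I' = A1 ++ z p :: A2.
  apply: (@sorted_eq_mem b) => //.
    apply: subseq_sorted sI; first exact: blt_trans.
    by rewrite E cat_subseq // subseq_cons.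
  move=> x; rewrite cI' memI' hI; split.
    case=> c _ n; have [h1 h2] : s x <> p /\ s x <> q.
      by split; [apply: pNI | apply: qNI]; apply/hI.
    have sw_x : s x = x by rewrite -[RHS](transpK p q) (transpN h1 h2).
    by rewrite sw_x in c n; split=> // e; apply: n.
  case=> cx xq; have [h1 h2] : x <> p /\ x <> q.
    by split; [apply: pNI | apply: qNI]; apply/hI.
  by rewrite transpN //; split=> //; case.
(* The consecutive letters are now z q, z p, and the exceptional choice is z q without z p. *)
rewrite sj E; apply: (@chain_sum_cancel _ _ t demazure F j p q A1 A2 _ _ (z q) (z p)) => //.
- by left.
- by apply: transpN => //; apply: hz.2.
- by apply: subI => x xA; rewrite E mem_cat xA.
- by apply: subI => x xA; rewrite E mem_cat !inE xA !orbT.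
- move=> S1 S0 S2 sub1 S0in sub2.
  have sub : subseq (S1 ++ S0 ++ S2) I.
    rewrite E (_ : z q :: z p :: A2 = [:: z q; z p] ++ A2) // !cat_subseq //.
    move: S0in; rewrite !inE => /or3P[] /eqP-> //=; rewrite ?eqxx //.
    by case: (z p == z q) => //=; rewrite eqxx.
  apply: demazure_des; apply: no_flip => //; [exact: sortS | exact: condI | |].
    by move=> /(mem_subseq sub) /qNI.
  move: S0in; rewrite !mem_cat !inE => /or3P[] /eqP->; rewrite !inE ?eqxx ?orbT //.
  by move/negP: qA1 => qA1; move/negP: qA2 => qA2 /orP[/(mem_subseq sub1)|/(mem_subseq sub2)].
- move=> S1 S2 sub1 sub2; have sub : subseq (S1 ++ z q :: S2) I.
    rewrite E cat_subseq //= eqxx.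
    exact: subseq_trans sub2 (subseq_cons _ _).
  apply: demazure_asc; apply: flip_val => //; [exact: sortS|exact: condI| |].
    by rewrite mem_cat mem_head orbT.
  rewrite mem_cat inE !negb_or; apply/and3P; split.
  + by apply: contra pA1; apply: mem_subseq.
  + by apply/eqP/nesym.
  by apply: contra pA2; apply: mem_subseq.
move=> S1 sub1; rewrite !word_cat /=.
set u := word j z S1.
have sub : subseq S1 I.
  by rewrite E; apply: subseq_trans sub1 _; apply: prefix_subseq.
have nS x : x \notin A1 -> x \notin S1 by apply: contra; apply: mem_subseq.
have [sS1 cS1] := (sortS sub, condI sub).
have [q1 q2 q3 q4 _] := cover_cond_neq hz jk cq.
have [p1 p2 p3 p4 _] := cover_cond_neq hz jk cp.
have uq : u (z q) = q.
  rewrite /u (word_out hz jk sS1 cS1) ?hz.1 //; first exact: nS.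
  by apply/negP => /(mem_subseq sub) /qNI.
have up : u (z p) = p.
  rewrite /u (word_out hz jk sS1 cS1) ?hz.1 //; first exact: nS.
  by apply/negP => /(mem_subseq sub) /pNI.
have hu : fpf_involution u by apply: word_fpf.
(* The prefix leaves the arcs at p and q untouched. Once the product is rewritten through the
   transposition of z p and z q, [conj_arcs] replaces that transposition by the one of p and q. *)
have -> : conj_by (transp (z p) j) (conj_by (transp (z q) j) u) =
    conj_by (transp (z q) j) (conj_by (transp (z p) (z q)) u).
  by rewrite [RHS]conj_by_conj transpL (@transpN (z q) j (z p)) //; apply: nesym.
have uP : u p = z p by rewrite -{1}up hu.1.
have uQ : u q = z q by rewrite -{1}uq hu.1.
have := @conj_arcs u p q hu; rewrite uP uQ => -> //.
by rewrite conj_by_conj sj (@transpN p q (z q)) ?conj_byK //; apply: hz.2.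
Qed.

Lemma transition_away : chain_sum t demazure j I z = chain_sum t F (s j) I' z'.
Proof.
case: (pselect (cover_cond b z j p /\ cover_cond b z j q)) => [[]|nP]; first exact: transition_flip_pos.
case: (pselect (cover_cond b z j (z p) /\ cover_cond b z j (z q))) => [[]|nV].
  exact: transition_flip_val.
exact: transition_noflip.
Qed.

End Away.

(** Adding t F to the image -t F annihilates every word that contains a letter outside [P]. *)
Lemma transition_filter (P : pred nat) :
  (forall S, subseq S I -> ~~ all P S -> demazure (word j z S) = - t *: F (word j z S)) ->
  (forall S, subseq S (filter P I) ->
     demazure (word j z S) = F (conj_by s (word j z S))) ->
  chain_sum t demazure j I z + t *: chain_sum t F j I z =
  chain_sum t F (s j) (map s (filter P I)) z' + t *: chain_sum t F j (filter P I) z.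
Proof.
move=> h0 h1; rewrite -chain_sumD (@chain_sum_filter _ _ _ _ _ P).
  rewrite chain_sumD -chain_sum_conj; congr (_ + _).
  exact: eq_chain_sum.
by move=> S sub nP; rewrite h0 // scaleNr addNr.
Qed.

Section AtOpener.
Hypothesis jp : j = p.
Let P a := blt b (z q) (z a) && (a != z q).

Let memP (x : nat) : x \in I' <-> x \in rcons (filter P I) p.
Proof.
have npq := zpq hz zqp; have zqq := hz.2 q; have kp : z p <> p := hz.2 p.
have zjp : z j = z p by rewrite jp.
rewrite mem_rcons inE mem_filter hI' -{1}(transpK p q x) cover_cond_conj //.
case: (eqVneq x p) => [->|/eqP xp] /=.
  rewrite transpL; split=> // _; split; rewrite ?blt_transp //.
  - by clear - pq jp; alia.
  - by clear - des zqp npq zjp; blia.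
  - by clear - pq jp zqq zqp; alia.
  by move=> e; rewrite !blt_transp //; clear -pq jp zqq zqp; alia.
case: (eqVneq x q) => [->|/eqP xq].
  rewrite transpR; split=> [[]|]; first by rewrite jp blt_irr.
  by move=> /andP[_ /hI[h _ _ _]]; move: h; clear -jp pq; alia.
have sxE : s x = x by rewrite transpN.
rewrite !sxE; have zxq : z x <> z q by move/(fpf_inj hz).
have zxp : z x <> z p by move/(fpf_inj hz).
have B u v : blt b (s u) (s v) =
    blt b u v && ~~ ((u == p) && (v == q)) || (u == q) && (v == p).
  exact: blt_transp.
have Bx u : blt b x (s u) = (blt b x u && ~~ ((u == p) && (x == q))) || (x == q) && (u == p).
  by have := B x u; rewrite sxE; clear -xp xq pq; move=> ->; alia.
split.
  rewrite !Bx !B => -[c1 c2 c3 c4].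
  have xj : blt b x j by clear -c1 xq pq; alia.
  have xk : blt b (z x) (z j) by clear - c2 kp zjp; blia.
  have zxj : z x <> p.
    move=> h; have e : x = z j by rewrite jp -h hz.1.
    by rewrite e in xj; clear - xj jk; blia.
  have zqx : z x <> q.
    by move=> h; apply: c3; rewrite h; clear -xj jp pq xp xq; alia.
  apply/andP; split.
    rewrite /P; apply/andP; split; last by apply/eqP => h; apply: zqx; rewrite h hz.1.
    have := c4 q; rewrite !Bx !B; clear - xj des zqp npq zqq zxq pq kp zxj jp zjp zqx.
    by alia.
  apply/hI; split=> //.
    by clear - c3 pq xp xq zxj zqx jp; alia.
  move=> e e1 e2 e3 e4; have := c4 e; rewrite !Bx !B.
  by clear - e1 e2 e3 e4 zxj pq kp npq xp xq jp zjp; alia.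
move=> /andP[/andP[Px /eqP xzq] /hI[xj xk c3 c4]].
have zxq' : z x <> q by move=> h; apply: xzq; rewrite -h hz.1.
rewrite !Bx !B; split.
- by clear - xj xq pq jp; alia.
- by clear - xk npq kp zjp; blia.
- by clear -c3 zxq' xq xp pq jp; alia.
move=> e; rewrite !Bx !B => e1 e2 e3 e4.
case: (eqVneq e q) => [eq|/eqP eq].
  by subst e; move: e3 Px zxq'; rewrite /P; clear; blia.
apply: (c4 e).
- by clear - e1 xq; blia.
- by clear - e2 eq; blia.
- by clear - e3 zxq'; blia.
by clear - e4 kp zjp; blia.
Qed.

(** The conjugation moves j from p to q, and p becomes the last cover. A word with a letter
    violating [P] has no usable descent and vanishes by [transition_filter]. Every other word w
    contributes F(s w s) + t F(w), that is, the omission or the use of the new last letter p, whose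
    conjugation by the transposition of p and q undoes s. *)
Lemma transition_opener :
  chain_sum t demazure j I z + t *: chain_sum t F j I z = chain_sum t F (s j) I' z'.
Proof.
have zjp : z j = z p by rewrite jp.
have lt S a : subseq S I -> a \in S -> blt b a p.
  by move=> sub aS; case: (condI sub aS); rewrite jp.
have pq' : blt b p q by clear -pq; alia.
have qN S : subseq S I -> q \notin S.
  by move=> sub; apply/negP => /(lt _ _ sub); clear -pq'; blia.
have pN S : subseq S I -> p \notin S.
  by move=> sub; apply/negP => /(lt _ _ sub); rewrite blt_irr.
have subF : subseq (filter P I) I := filter_subseq _ _.
have qj : q <> j by clear -jp pq; alia.
have qk : q <> z j by rewrite zjp; apply/nesym/(zpq hz zqp).
have -> : I' = rcons (filter P I) p.
  apply: (@sorted_eq_mem b) => //.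
  rewrite -cats1 (sorted_pairwise (@blt_trans b)) pairwise_cat /= andbT.
  rewrite -(sorted_pairwise (@blt_trans b)) (sortS subF) andbT.
  by apply/allP => x xI /=; rewrite andbT; apply: lt subF xI.
rewrite (@transition_filter P).
- rewrite mapid ?pN ?qN // -cats1 chain_sum_cat.
  rewrite [in RHS](@eq_chain_sum _ _ _ _ (fun w => F w + t *: F (conj_by s w))).
    rewrite chain_sumD chain_sum_conj conj_byK mapid ?pN ?qN // transpK.
    by congr (_ + _).
  by move=> S _ /=; rewrite jp transpL.
- move=> S sub nP; apply: demazure_nondescent.
  case: (boolP (z q \in S)) => zqS.
    have [hq _] := word_val hz jk (sortS sub) (condI sub) zqS.
    rewrite hz.1 in hq; case: hq => [-> | [wS lt1]]; first by rewrite -jp eqxx andbF.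
    (* The value at q is now a letter, hence before j = p. The value at j must be compared with it:
       minimality bounds it by the partner of that letter. *)
    have [[S0 _]|[_ wj]] := word_j hz jk (sortS sub) (condI sub).
      by rewrite S0 in zqS.
    have := wj _ wS; rewrite -jp; set a := word j z S q in wS lt1 *.
    have [_ _ _ _ h] := cover_cond_neq hz jk (condI sub wS).
    have := cover_cond_anti hz jk (condI sub zqS) (condI sub wS) lt1; rewrite hz.1.
    by move: h; clear -jp pq; alia.
  have [a aS na] : exists2 a, a \in S & ~~ P a by apply/allPn.
  have zaq : a <> z q by move=> h; rewrite -h aS in zqS.
  have zac : z a <> z q by move/(fpf_inj hz) => e; move: (qN _ sub); rewrite -e aS.
  rewrite (word_out hz jk (sortS sub) (condI sub) (qN _ sub) zqS qj qk).
  have [[S0 _]|[_ wj]] := word_j hz jk (sortS sub) (condI sub).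
    by rewrite S0 in aS.
  have := wj _ aS; move: na; rewrite /P -jp; clear - zaq zac; blia.
move=> S sub; have subI := subseq_trans sub subF.
apply: demazure_des.
have hP a : a \in S -> P a by move/(mem_subseq sub); rewrite mem_filter => /andP[].
have zqS : z q \notin S by apply/negP => /hP; rewrite /P eqxx andbF.
rewrite (word_out hz jk (sortS subI) (condI subI) (qN _ subI) zqS qj qk) -jp.
rewrite jp; apply/andP; split; last exact/eqP.
rewrite -jp; have [[_ ->]|[[a aS ->] _]] := word_j hz jk (sortS subI) (condI subI).
  by rewrite zjp.
by case/andP: (hP a aS).
Qed.
End AtOpener.

Section AtCloser.
Hypothesis kp : z j = p.
Let P a := blt b (z q) a.
Let jE : z p = j. Proof. by rewrite -kp hz.1. Qed.

Let memP (x : nat) : x \in I' <-> x \in z q :: filter P I.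
Proof.
have npq := zpq hz zqp; have zqq := hz.2 q.
have jp : blt b j p by rewrite -kp.
have c1 : blt b (z q) j by rewrite -jE.
rewrite inE mem_filter hI' -{1}(transpK p q x) cover_cond_conj // kp.
have B u v : blt b (s u) (s v) =
    blt b u v && ~~ ((u == p) && (v == q)) || (u == q) && (v == p).
  exact: blt_transp.
case: (eqVneq x p) => [->|/eqP xp] /=.
  rewrite transpL !B; have -> : (p == z q) = false by apply/eqP/nesym.
  by split=> [[h _ _ _]|/andP[_ /hI[h _ _ _]]]; move: h; clear -jp pq; alia.
case: (eqVneq x q) => [->|/eqP xq].
  rewrite transpR !B; have -> : (q == z q) = false by apply/eqP/nesym.
  by split=> [[h _ _ _]|/andP[_ /hI[h _ _ _]]]; move: h; clear -jp pq; alia.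
have sxE : s x = x by rewrite transpN.
have Bx u : blt b x (s u) = (blt b x u && ~~ ((u == p) && (x == q))) || (x == q) && (u == p).
  by have := B x u; rewrite sxE; clear -xp xq pq; move=> ->; alia.
rewrite !sxE !Bx !B; case: (eqVneq x (z q)) => [->|/eqP xzq] /=.
  rewrite hz.1; split=> // _; split.
  - by clear -c1 zqp; alia.
  - by clear -pq; alia.
  - by clear - c1 pq jp; alia.
  by move=> e; rewrite !B; clear -pq; alia.
have zxq : z x <> q by move=> h; apply: xzq; rewrite -h hz.1.
split.
  move=> [x1 x2 x3 x4].
  have xj : blt b x j by clear - x1 xq jp; alia.
  have xk : blt b (z x) p by clear - x2 zxq pq; alia.
  apply/andP; split.
    have := x4 (z q); rewrite !Bx !B hz.1 /P.
    by clear -xj xk c1 zqp xzq pq jp; alia.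
  apply/hI; split=> //; first by rewrite kp.
    by clear - x3 zxq xk jp pq xp xq; alia.
  move=> e; rewrite kp => e1 e2 e3 e4; have := x4 e; rewrite !Bx !B.
  by clear - e1 e2 e3 e4 pq jp xp xq zxq; alia.
rewrite /P => /andP[Px /hI[xj xk x3 x4]]; rewrite kp in xk x4; split.
- by clear - xj xp xq jp pq; alia.
- by clear - xk pq; alia.
- by clear - x3 zxq xk jp pq xp xq; alia.
move=> e; rewrite !Bx !B => e1 e2 e3 e4.
case: (eqVneq (z e) q) => [eq|/eqP eq].
  have ee : e = z q by rewrite -eq hz.1.
  by rewrite ee in e1; clear - e1 Px xq; blia.
apply: (x4 e).
- by clear - e1 xq; blia.
- by clear - e2 jp pq; alia.
- by clear - e3 zxq; blia.
by clear - e4 eq pq; alia.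
Qed.

Lemma transition_closer :
  chain_sum t demazure j I z + t *: chain_sum t F j I z = chain_sum t F (s j) I' z'.
Proof.
have npq := zpq hz zqp; have jp : blt b j p by rewrite -kp.
have pq' : blt b p q by clear -pq; alia.
have lt S a : subseq S I -> a \in S -> blt b a p.
  by move=> sub aS; case: (condI sub aS) => h _ _ _; move: h jp; clear; blia.
have qN S : subseq S I -> q \notin S.
  by move=> sub; apply/negP => /(lt _ _ sub); clear -pq'; blia.
have pN S : subseq S I -> p \notin S.
  by move=> sub; apply/negP => /(lt _ _ sub); rewrite blt_irr.
have zqN S : subseq S I -> z q \notin S.
  move=> sub; apply/negP => /(condI sub)[_ + _ _]; rewrite hz.1 kp.
  by clear -pq'; blia.
have subF : subseq (filter P I) I := filter_subseq _ _.
have qj : q <> j by clear -jp pq; alia.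
have jq : j <> q by apply: nesym.
have jp' : j <> p by clear -jp; blia.
have qk : q <> z j by rewrite kp; clear -pq; alia.
have sj : s j = j by apply: transpN.
have -> : I' = z q :: filter P I.
  apply: (@sorted_eq_mem b) => //.
  rewrite (sorted_pairwise (@blt_trans b)) /= -(sorted_pairwise (@blt_trans b)).
  rewrite (sortS subF) andbT.
  by apply/allP => x; rewrite mem_filter => /andP[].
rewrite (@transition_filter P).
- rewrite sj mapid ?pN ?qN //=; congr (_ + _ *: chain_sum _ _ _ _ _).
  (* As z p = j, the conjugation by the new first letter z q undoes s, so that branch of the chain
     starts again from z. *)
  rewrite -(conj_arcs hz npq) jE transpC conj_byK //.
- move=> S sub; move/allPn => [a aS na]; apply: demazure_asc.
  rewrite (word_out hz jk (sortS sub) (condI sub) (qN _ sub) (zqN _ sub) qj qk).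
  have [[S0 _]|[_ wk]] := word_k hz jk (sortS sub) (condI sub).
    by rewrite S0 in aS.
  have zaq : a <> z q by move=> h; have := zqN _ sub; rewrite -h aS.
  have := wk _ aS; move: na; rewrite /P kp; clear - zaq; blia.
move=> S sub; have subI := subseq_trans sub subF.
apply: demazure_des.
have hP a : a \in S -> P a by move/(mem_subseq sub); rewrite mem_filter => /andP[].
rewrite (word_out hz jk (sortS subI) (condI subI) (qN _ subI) (zqN _ subI) qj qk).
apply/andP; split; last exact/eqP.
rewrite -kp; have [[_ ->]|[kS _]] := word_k hz jk (sortS subI) (condI subI).
  by rewrite -jE.
exact: hP.
Qed.
End AtCloser.

End Transition.

                            

                                                                        
                                                 
(** * The ring of polynomials with its exchanges of variables *)

Record variable_ring := VariableRing {
  vring :> comNzRingType;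
  vbeta : vring;
  X : nat -> vring;
  sw : nat -> vring -> vring;
  swD : forall i f g, sw i (f + g) = sw i f + sw i g;
  swN : forall i f, sw i (- f) = - sw i f;
  swM : forall i f g, sw i (f * g) = sw i f * sw i g;
  sw1 : forall i, sw i 1 = 1;
  sw_beta : forall i, sw i vbeta = vbeta;
  swX : forall i a, sw i (X a) = X (transp i i.+1 a);
  swK : forall i f, sw i (sw i f) = f;
  sw_braid : forall i f, sw i (sw i.+1 (sw i f)) = sw i.+1 (sw i (sw i.+1 f));
  sw_far : forall i k f, (i.+1 < k)%N -> sw i (sw k f) = sw k (sw i f);
  XB_inj : forall i k f g, i <> k -> (X i - X k) * f = (X i - X k) * g -> f = g
}.
Arguments vbeta {v}.
Arguments X {v}.
Arguments sw {v}.

Lemma transp_braid i a : transp i i.+1 (transp i.+1 i.+2 (transp i i.+1 a)) =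
  transp i.+1 i.+2 (transp i i.+1 (transp i.+1 i.+2 a)).
Proof.
have [h1 h2 h3] : [/\ i.+2 <> i, i.+2 <> i.+1 & i <> i.+1] by split; lia.
rewrite (transp_transp i i.+1 i.+1 i.+2) (transp_transp i.+1 i.+2 i i.+1) !transpK.
by rewrite transpR transpL (transpN h1 h2) (@transpN i.+1 i.+2 i) //; apply: nesym.
Qed.

Section Substitution.
Variable h : nat -> ZbetaX.

Definition subst_mon (m : {cmonom nat}) : ZbetaX :=
  \prod_(a <- finsupp m) h a ^+ m a.

Lemma subst_monEw (d : {fset nat}) (m : {cmonom nat}) : (finsupp m `<=` d)%fset ->
  subst_mon m = \prod_(a <- d) h a ^+ m a.
Proof.
move=> le; rewrite /subst_mon (big_fset_incl _ le) // => a ad.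
by rewrite -cmE_eq0 => /eqP->.
Qed.

Lemma subst_mon_morphism : mmorphism subst_mon.
Proof.
split; last by rewrite /subst_mon mdom1 big_seq_fset0.
move=> m1 m2; pose d := (finsupp m1 `|` finsupp m2)%fset.
rewrite !(@subst_monEw d) ?fsubsetUl ?fsubsetUr ?mdomD //.
by rewrite -big_split /=; apply: eq_bigr => a _; rewrite cmM exprD.
Qed.

HB.instance Definition _ := isMultiplicative.Build _ _ subst_mon subst_mon_morphism.

Lemma subst_varsE (f : ZbetaX) :
  subst_vars h f = \sum_(m <- msupp f) (f@_m)%:MP * subst_mon m.
Proof. by []. Qed.

Lemma subst_varsD f g : subst_vars h (f + g) = subst_vars h f + subst_vars h g.
Proof. exact: mmapD. Qed.

Lemma subst_varsZ c f : subst_vars h (c *: f) = c *: subst_vars h f.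
Proof. by rewrite -[RHS]mul_malgC; apply: (@mmapZ _ _ _ _ subst_mon). Qed.

Lemma subst_varsM f g : subst_vars h (f * g) = subst_vars h f * subst_vars h g.
Proof. exact: (@mmap_is_multiplicative _ _ _ _ subst_mon).1. Qed.

Lemma subst_vars1 : subst_vars h 1 = 1.
Proof. exact: (@mmap_is_multiplicative _ _ _ _ subst_mon).2. Qed.

Lemma subst_varsX a : subst_vars h (x_ a) = h a.
Proof.
rewrite /subst_vars /x_ mmapU /= mul1r.
by rewrite mdomU big_seq_fset1 cmUU expr1.
Qed.
End Substitution.

Lemma mon_mul (m n : xmonom) : (<< m >> : ZbetaX) * << n >> = << mmul m n >>.
Proof. by rewrite malgM_def fgmulUU mulr1. Qed.

Lemma x_exp a n : exists2 m : {cmonom nat}, x_ a ^+ n = << m >>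
  & forall c, m c = (if c == a then n else 0)%N.
Proof.
elim: n => [|n [m e hm]].
  by exists (mone : {cmonom nat}) => [|c]; rewrite ?expr0 // cm1 if_same.
exists (mmul (ucm a) m); first by rewrite exprS e; exact: mon_mul.
by move=> c; rewrite cmM cmU hm eq_sym; case: eqP.
Qed.

Lemma subst_mon_x (m : {cmonom nat}) : subst_mon x_ m = << m >>.
Proof.
suff [M e hM] : exists2 M : {cmonom nat}, subst_mon x_ m = << M >>
    & forall c, M c = (if c \in enum_fset (finsupp m) then m c else 0)%N.
  rewrite e; congr (<< _ >>); apply/eqP/cmP => c; rewrite hM.
  by case: mdomP.
rewrite /subst_mon; have := fset_uniq (finsupp m); elim: (enum_fset _) => [|a r IH] /=.
  by move=> _; exists (mone : {cmonom nat}) => [|c]; rewrite ?big_nil ?cm1.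
move=> /andP[ar /IH[M e hM]]; have [N e2 hN] := x_exp a (m a).
exists (mmul N M); first by rewrite big_cons e e2; exact: mon_mul.
move=> c; rewrite cmM hM hN inE; case: eqP => [->|_] //=.
by rewrite (negPf ar) addn0.
Qed.

Lemma subst_vars_id f : subst_vars x_ f = f.
Proof.
rewrite [RHS]monalgE /subst_vars mmapE; apply: eq_bigr => m _.
rewrite -/(subst_mon x_ m) subst_mon_x malgM_def fgmulUU mulr1.
by rewrite mul1m.
Qed.

Lemma subst_vars_comp h1 h2 f :
  subst_vars h1 (subst_vars h2 f) = subst_vars (fun a => subst_vars h1 (h2 a)) f.
Proof.
have h10 : subst_vars h1 0 = 0 by have := subst_varsZ h1 0 0; rewrite !scale0r.
rewrite (subst_varsE h2) (subst_varsE _ f).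
rewrite (big_morph _ (subst_varsD h1) h10); apply: eq_bigr => m _.
rewrite subst_varsM; congr (_ * _).
  by rewrite -[X in subst_vars _ X]mulr1 mul_malgC subst_varsZ subst_vars1 -mul_malgC mulr1.
rewrite (big_morph _ (subst_varsM h1) (subst_vars1 h1)); apply: eq_bigr => a _.
by elim: (m a) => [|n IH]; rewrite ?expr0 ?subst_vars1 // !exprS subst_varsM IH.
Qed.

Section VariableSwap.
Variable i : nat.
Lemma s_D f g : s_ i (f + g) = s_ i f + s_ i g. Proof. exact: subst_varsD. Qed.
Lemma s_M f g : s_ i (f * g) = s_ i f * s_ i g. Proof. exact: subst_varsM. Qed.
Lemma s_Z c f : s_ i (c *: f) = c *: s_ i f. Proof. exact: subst_varsZ. Qed.
Lemma s_1 : s_ i 1 = 1. Proof. exact: subst_vars1. Qed.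
Lemma s_N f : s_ i (- f) = - s_ i f.
Proof. by rewrite -[- f]scaleN1r s_Z scaleN1r. Qed.
Lemma s_X a : s_ i (x_ a) = x_ (transp i i.+1 a). Proof. exact: subst_varsX. Qed.

Lemma s_K f : s_ i (s_ i f) = f.
Proof.
rewrite [LHS]subst_vars_comp -[RHS]subst_vars_id; congr (subst_vars _ f).
by apply/funext => a; rewrite subst_varsX transpK.
Qed.
End VariableSwap.

Lemma s_subst i h f : s_ i (subst_vars (fun a => x_ (h a)) f) =
  subst_vars (fun a => x_ (transp i i.+1 (h a))) f.
Proof.
rewrite [LHS]subst_vars_comp; congr (subst_vars _ f); apply/funext => a.
exact: s_X.
Qed.

Lemma s_far i k f : (i.+1 < k)%N -> s_ i (s_ k f) = s_ k (s_ i f).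
Proof.
move=> ik; have e1 := s_subst i (transp k k.+1) f.
have e2 := s_subst k (transp i i.+1) f.
apply: etrans e1 _; apply: etrans (esym e2).
apply: (congr1 (fun h => subst_vars h f)); apply/funext => a.
apply: (congr1 x_); rewrite [LHS]transp_transp.
have -> : transp i i.+1 k = k by apply: transpN; lia.
by have -> : transp i i.+1 k.+1 = k.+1 by apply: transpN; lia.
Qed.

Lemma s_braid i f : s_ i (s_ i.+1 (s_ i f)) = s_ i.+1 (s_ i (s_ i.+1 f)).
Proof.
have e1 := etrans (congr1 (s_ i) (s_subst i.+1 (transp i i.+1) f))
  (s_subst i (fun a => transp i.+1 i.+2 (transp i i.+1 a)) f).
have e2 := etrans (congr1 (s_ i.+1) (s_subst i (transp i.+1 i.+2) f))
  (s_subst i.+1 (fun a => transp i i.+1 (transp i.+1 i.+2 a)) f).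
apply: etrans e1 _; apply: etrans (esym e2).
apply: (congr1 (fun h => subst_vars h f)); apply/funext => a.
by apply: (congr1 x_); exact: transp_braid.
Qed.

Lemma mcoeff_x_mul a (d : ZbetaX) (M : {cmonom nat}) :
  (x_ a * d)@_M = if M a is _.+1 then d@_(divcm M (ucm a)) else 0.
Proof.
rewrite /x_ mcoeffMl msuppU1 big_seq_fset1 mcoeffUU.
have eqE (k : {cmonom nat}) : (mmul (ucm a) k == M) =
    (0 < M a)%N && (k == divcm M (ucm a)).
  apply/eqP/andP => [<-|[M0 /eqP->]].
    split; first by rewrite cmM cmUU.
    by apply/cmP => c; rewrite divcmE cmM addKn.
  apply/eqP/cmP => c; rewrite cmM divcmE cmU.
  by case: eqP => [<-|_]; rewrite ?subnKC ?subn0.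
case E: (M a) => [|n].
  by rewrite big1 // => k _; rewrite eqE E mulr0n.
rewrite [in RHS](monalgE d) raddf_sum; apply: eq_bigr => k _ /=.
by rewrite mcoeffU mul1r eqE E.
Qed.

(** If x_i d = x_k d, the coefficient of m in d equals that of x_i m / x_k, or is 0 when x_k does
    not divide m. Induction on the exponent of x_k makes every coefficient vanish. *)
Lemma xB_inj i k f g : i <> k -> (x_ i - x_ k) * f = (x_ i - x_ k) * g -> f = g.
Proof.
move=> ik /eqP; rewrite -subr_eq0 -mulrBr => /eqP; set d := f - g => e.
have {}e : x_ i * d = x_ k * d by apply/eqP; rewrite -subr_eq0 -mulrBl e.
suff h (n : nat) (m : {cmonom nat}) : (m k < n)%N -> d@_m = 0.
  apply/eqP; rewrite -subr_eq0 -/d; apply/eqP/malgP => m; rewrite mcoeff0.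
  exact: (h _ _ (ltnSn _)).
elim: n m => [|n IH] m mn; first by exfalso; rewrite ltn0 in mn.
have mE : divcm (mulcm (ucm i) m) (ucm i) = m.
  by apply/eqP/cmP => c; rewrite divcmE mulcmE addKn.
have iE : mulcm (ucm i) m i = (m i).+1 by rewrite mulcmE ucmE eqxx.
have kE : mulcm (ucm i) m k = m k.
  by rewrite mulcmE ucmE; move/eqP/negPf: ik => ->.
have e1 := mcoeff_x_mul i d (mulcm (ucm i) m); rewrite iE mE in e1.
have e2 := mcoeff_x_mul k d (mulcm (ucm i) m); rewrite kE -e e1 in e2.
rewrite e2; case E: (m k) => [|c]; [exact: erefl | apply: IH].
rewrite divcmE mulcmE !ucmE eqxx.
by move/eqP/negPf: (ik) => ->; rewrite E in mn *; lia.
Qed.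

Lemma beta_subproof : {c : ZbetaX | (forall f, beta *: f = c * f) /\
  forall i, s_ i c = c}.
Proof.
exists (beta *: 1); split=> [f|i]; first by rewrite -scalerAl mul1r.
by rewrite s_Z s_1.
Qed.

Definition betaX : ZbetaX := sval beta_subproof.

Lemma scale_beta f : beta *: f = betaX * f.
Proof. exact: (svalP beta_subproof).1. Qed.

Lemma s_beta i : s_ i betaX = betaX.
Proof. exact: (svalP beta_subproof).2. Qed.

(** The divided difference calculus uses only the fields of the record. Over an abstract ring,
    identities are settled by [ring] without meeting monomials, and scaling by beta becomes
    multiplication by an element that every exchange fixes. *)
Definition ZbetaX_variable_ring : variable_ring :=
  @VariableRing ZbetaX betaX x_ s_ s_D s_N s_M s_1 s_beta s_X s_K s_braid s_far xB_inj.

(** * The beta divided difference as a relation: Leibniz and braid rules *)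

Section DemazureOperator.
Variables (V : variable_ring) (i : nat).
Local Notation x := (X i).
Local Notation y := (X i.+1).
Implicit Types f g c : V.

Definition bdivdiff f g : Prop :=
  (x - y) * g = (1 + vbeta * y) * f - sw i ((1 + vbeta * y) * f).

Lemma sw_Xi : sw i x = y :> V.
Proof. by rewrite swX transpL. Qed.

Lemma sw_XSi : sw i y = x :> V.
Proof. by rewrite swX transpR. Qed.

Lemma sw_X_out a : a <> i -> a <> i.+1 -> sw i (X a) = X a :> V.
Proof. by move=> h1 h2; rewrite swX transpN. Qed.

Lemma XB_cancel f g : (x - y) * f = (x - y) * g -> f = g.
Proof. by apply: XB_inj => e; have := n_Sn i e. Qed.

Lemma bdivdiffE f g : bdivdiff f g <->
  (x - y) * g = (1 + vbeta * y) * f - (1 + vbeta * x) * sw i f.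
Proof. by rewrite /bdivdiff swM swD swM sw1 sw_beta sw_XSi. Qed.

Lemma bdivdiff_uniq f g h : bdivdiff f g -> bdivdiff f h -> g = h.
Proof.
rewrite !bdivdiffE => e1 e2; apply: XB_cancel.
exact: etrans e1 (esym e2).
Qed.

Lemma bdivdiffD c f g f' g' : bdivdiff f g -> bdivdiff f' g' ->
  sw i c = c -> bdivdiff (f + c * f') (g + c * g').
Proof.
rewrite !bdivdiffE swD swM => e1 e2 ->.
by rewrite mulrDr e1 mulrCA e2; ring.
Qed.

Lemma bdivdiff_sym f : sw i f = f -> bdivdiff f (- vbeta * f).
Proof. by rewrite bdivdiffE => ->; ring. Qed.

Lemma bdivdiff_image f g : bdivdiff f g -> sw i g = g.
Proof.
rewrite bdivdiffE => e; have := congr1 (sw i) e.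
rewrite swM !(swD, swN, swM, sw1, sw_beta, sw_Xi, sw_XSi, swK) => e2.
by apply: XB_cancel; rewrite e -opprB mulNr e2; ring.
Qed.

Lemma bdivdiffM c f g : sw i c = c -> bdivdiff f g ->
  bdivdiff (c * f) (c * g).
Proof. by rewrite !bdivdiffE swM mulrCA => -> ->; ring. Qed.

(** This rule and [bdivdiff_xSi] move the operator past a factor 1 + beta x. Their extra beta terms
    are the ones produced by [transition_opener] and [transition_closer]. *)
Lemma bdivdiff_xi f g : bdivdiff f g ->
  bdivdiff ((1 + vbeta * x) * f) ((1 + vbeta * y) * (g + vbeta * f)).
Proof.
rewrite !bdivdiffE swM swD swM sw1 sw_beta sw_Xi mulrCA mulrDr => ->; ring.
Qed.

Lemma bdivdiff_xSi f g : bdivdiff f g ->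
  bdivdiff ((1 + vbeta * y) * f)
    ((1 + vbeta * x) * g - vbeta * ((1 + vbeta * y) * f)).
Proof.
rewrite !bdivdiffE swM swD swM sw1 sw_beta sw_XSi mulrBr mulrCA => ->; ring.
Qed.

(** Expanding gives (1 + beta y)(x + c + beta x c) - (1 + beta x)(y + c + beta y c) = x - y. *)
Lemma bdivdiff_factor c g : sw i c = c -> sw i g = g ->
  bdivdiff ((x + c + vbeta * (x * c)) * g) g.
Proof.
rewrite bdivdiffE => hc hg.
rewrite !(swD, swM, sw_beta, sw_Xi) hc hg; ring.
Qed.
End DemazureOperator.

Section Braid.
Variables (V : variable_ring) (i : nat).
Local Notation x := (X i : V).
Local Notation y := (X i.+1 : V).
Local Notation z := (X i.+2 : V).
Implicit Types f g h : V.

Let h1 : i <> i.+1. Proof. by lia. Qed.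
Let h2 : i <> i.+2. Proof. by lia. Qed.
Let h3 : i.+1 <> i.+2. Proof. by lia. Qed.
Let sw_x : sw i.+1 x = x. Proof. exact: sw_X_out. Qed.
Let sz : sw i z = z. Proof. by apply: sw_X_out; apply: nesym. Qed.

(** Multiplying h by the product of the three differences of variables gives an expression in f, s_i
    f and s_{i+1} s_i f. The exchange s_i swaps the first two and fixes the third, by the braid
    relation and the symmetry of f. So this expression is antisymmetric under s_i. The product of
    differences is antisymmetric too, hence h is symmetric. *)
Lemma bdivdiff_braid_symL f g h : sw i.+1 f = f ->
  bdivdiff i f g -> bdivdiff i.+1 g h -> sw i h = h.
Proof.
move=> hf /bdivdiffE e1 /bdivdiffE e3.
have e2 := congr1 (sw i.+1) e1.
rewrite !(swD, swN, swM, sw1, sw_beta, sw_x, sw_Xi, hf) in e2.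
set f2 := sw i f in e1 e2; set f3 := sw i.+1 f2 in e2.
set g' := sw i.+1 g in e2 e3.
have E : (x - y) * ((x - z) * ((y - z) * h)) =
    (x - z) * ((1 + vbeta * z) * ((1 + vbeta * y) * f - (1 + vbeta * x) * f2))
    - (x - y) * ((1 + vbeta * y) * ((1 + vbeta * z) * f - (1 + vbeta * x) * f3)).
  by rewrite e3 -e1 -e2; ring.
have hf3 : sw i f3 = f3 by rewrite /f3 /f2 sw_braid hf.
have hf2 : sw i f2 = f by rewrite /f2 swK.
have E2 := congr1 (sw i) E.
rewrite !(swD, swN, swM, sw1, sw_beta, sw_Xi, sw_XSi, sz, hf2, hf3) -/f2 in E2.
apply: (XB_inj h1); apply: (XB_inj h2); apply: (XB_inj h3).
have E3 : (y - x) * ((y - z) * ((x - z) * sw i h)) =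
  - ((x - y) * ((x - z) * ((y - z) * h))) by rewrite E2 E; ring.
transitivity (- ((y - x) * ((y - z) * ((x - z) * sw i h)))); first by ring.
by rewrite E3; ring.
Qed.

Lemma bdivdiff_braid_symR f g h : sw i f = f ->
  bdivdiff i.+1 f g -> bdivdiff i g h -> sw i.+1 h = h.
Proof.
move=> hf /bdivdiffE e1 /bdivdiffE e3.
have e2 := congr1 (sw i) e1.
rewrite !(swD, swN, swM, sw1, sw_beta, sz, sw_XSi, hf) in e2.
set f2 := sw i.+1 f in e1 e2; set f3 := sw i f2 in e2.
set g' := sw i g in e2 e3.
have E : (x - z) * ((y - z) * ((x - y) * h)) =
    (x - z) * ((1 + vbeta * y) * ((1 + vbeta * z) * f - (1 + vbeta * y) * f2))
    - (y - z) * ((1 + vbeta * x) * ((1 + vbeta * z) * f - (1 + vbeta * x) * f3)).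
  by rewrite e3 -e1 -e2; ring.
have hf3 : sw i.+1 f3 = f3 by rewrite /f3 /f2 -sw_braid hf.
have hf2 : sw i.+1 f2 = f by rewrite /f2 swK.
have E2 := congr1 (sw i.+1) E.
rewrite !(swD, swN, swM, sw1, sw_beta, sw_Xi, sw_XSi, sw_x, hf2, hf3) -/f2 in E2.
apply: (XB_inj h1); apply: (XB_inj h2); apply: (XB_inj h3).
have E3 : (x - y) * ((z - y) * ((x - z) * sw i.+1 h)) =
  - ((x - z) * ((y - z) * ((x - y) * h))) by rewrite E2 E; ring.
transitivity (- ((x - y) * ((z - y) * ((x - z) * sw i.+1 h)))); first by ring.
by rewrite E3; ring.
Qed.
End Braid.

                              

(** * Inversions, the length function and the cover relation *)

Lemma sum_reindex n (w : nat -> nat) (H : nat -> nat) : injective w ->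
  (forall x, (x < n)%N -> (w x < n)%N) ->
  (\sum_(0 <= x < n) H (w x) = \sum_(0 <= x < n) H x)%N.
Proof.
move=> inj wn; rewrite -(big_map w xpredT H); apply: perm_big.
have u : uniq (map w (index_iota 0 n)) by rewrite map_inj_uniq ?iota_uniq.
apply: uniq_perm => //; first exact: iota_uniq.
have sub : {subset map w (index_iota 0 n) <= index_iota 0 n}.
  by move=> x /mapP[y]; rewrite !mem_index_iota /= => yn ->; apply: wn.
by have [|_] := uniq_min_size u sub; rewrite ?size_map.
Qed.

Definition inversions (n : nat) (w : nat -> nat) : nat :=
  (\sum_(0 <= x < n) \sum_(0 <= y < n) ((x < y) && (w y < w x)))%N.

                                                                                    
Definition between (n : nat) (w : nat -> nat) i j : nat :=
  (\sum_(0 <= e < n) [&& i < e, e < j, w i < w e & w e < w j])%N.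

Lemma between_eq0 n w i j : (j <= n)%N -> between n w i j = 0%N <->
  forall e, (i < e < j)%N -> ~~ (w i < w e < w j)%N.
Proof.
move=> jn; split.
  move=> /eqP; rewrite sum_nat_seq_eq0 => /allP h e /andP[ie ej].
  have := h e; rewrite mem_index_iota ie ej /= (leq_trans ej jn).
  by case: (_ && _) => // /(_ isT).
move=> h; apply/eqP; rewrite sum_nat_seq_eq0; apply/allP => e _ /=.
have := h e; case: (i < e)%N; case: (e < j)%N => //= /(_ isT).
by case: (_ && _).
Qed.

Lemma transp_lt n i j x : (i < n)%N -> (j < n)%N -> (x < n)%N -> (transp i j x < n)%N.
Proof. by rewrite /transp => *; case: eqP => // _; case: eqP. Qed.

Lemma sum_bigD2 n i j (H : nat -> nat) : (i < n)%N -> (j < n)%N -> i <> j ->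
  (\sum_(0 <= x < n) H x =
   H i + H j + \sum_(0 <= x < n | (x != i) && (x != j)) H x)%N.
Proof.
move=> hi hj ij; rewrite (bigD1_seq i) ?iota_uniq ?mem_index_iota //=.
rewrite -addnA; congr (_ + _)%N; rewrite -big_filter.
rewrite (bigD1_seq j) ?filter_uniq ?iota_uniq ?mem_filter ?mem_index_iota //=.
  rewrite big_filter_cond; congr (_ + _)%N; apply: eq_bigl => x; lia.
by rewrite hj andbT; apply/eqP; apply: nesym.
Qed.

(** The pair i, j itself becomes inverted, and each point lying between in position and value
    becomes inverted with both ends. For any other point the comparisons with i and j contribute the
    same total as before. *)
Lemma inversions_transp n w i j : injective w -> (i < j < n)%N -> (w i < w j)%N ->
  inversions n (w \o transp i j) = (inversions n w + 1 + 2 * between n w i j)%N.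
Proof.
move=> inj /andP[ij jn] wij; have hi := ltn_trans ij jn.
have nij : i <> j by lia.
pose g x y := nat_of_bool ((transp i j x < transp i j y) && (w y < w x))%N.
pose f x y := nat_of_bool ((x < y) && (w y < w x))%N.
have tinj := can_inj (transpK i j).
have tn x : (x < n)%N -> (transp i j x < n)%N by apply: transp_lt.
have -> : inversions n (w \o transp i j) =
    (\sum_(0 <= x < n) \sum_(0 <= y < n) g x y)%N.
  rewrite /inversions -(sum_reindex _ tinj tn); apply: eq_bigr => x _ /=.
  rewrite -(sum_reindex _ tinj tn); apply: eq_bigr => y _ /=.
  by rewrite !transpK.
rewrite /inversions -/f /between.
have split2 (h : nat -> nat -> nat) :
    (\sum_(0 <= x < n) \sum_(0 <= y < n) h x y = h i i + h i j + h j i + h j j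
    + \sum_(0 <= x < n | (x != i) && (x != j)) (h i x + h j x + h x i + h x j)
    + \sum_(0 <= x < n | (x != i) && (x != j))
        \sum_(0 <= y < n | (y != i) && (y != j)) h x y)%N.
  rewrite (sum_bigD2 _ hi jn nij) !(sum_bigD2 (h _) hi jn nij).
  under [X in (_ + X = _)%N]eq_bigr => x _ do rewrite (sum_bigD2 _ hi jn nij).
  by rewrite !big_split /=; lia.
rewrite !split2 (sum_bigD2 _ hi jn nij).
have -> : (\sum_(0 <= x < n | (x != i) && (x != j))
    \sum_(0 <= y < n | (y != i) && (y != j)) g x y =
  \sum_(0 <= x < n | (x != i) && (x != j))
    \sum_(0 <= y < n | (y != i) && (y != j)) f x y)%N.
  apply: eq_bigr => x /andP[/eqP xi /eqP xj]; apply: eq_bigr => y.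
  by move=> /andP[/eqP yi /eqP yj]; rewrite /g !transpN.
have -> : (\sum_(0 <= x < n | (x != i) && (x != j)) (g i x + g j x + g x i + g x j) =
   \sum_(0 <= x < n | (x != i) && (x != j)) (f i x + f j x + f x i + f x j) +
   2 * \sum_(0 <= x < n | (x != i) && (x != j))
     [&& i < x, x < j, w i < w x & w x < w j])%N.
  rewrite big_distrr /= -big_split; apply: eq_bigr => x /andP[/eqP xi /eqP xj].
  rewrite /g /f transpL transpR (transpN xi xj) /=.
  have : w x <> w i by move/inj.
  have : w x <> w j by move/inj.
  by clear -xi xj ij wij; lia.
rewrite /g /f transpL transpR.
by clear -ij wij; lia.
Qed.

Lemma inversions_inv n w w' : cancel w w' -> cancel w' w ->
  (forall x, (x < n)%N -> (w' x < n)%N) -> inversions n w' = inversions n w.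
Proof.
move=> wK w'K w'n; have inj := can_inj w'K.
rewrite [RHS]/inversions exchange_big /= -[RHS](sum_reindex _ inj w'n).
apply: eq_bigr => x _; rewrite -[RHS](sum_reindex _ inj w'n); apply: eq_bigr => y _.
by rewrite !w'K andbC.
Qed.

(** A finite stage of the infinite group: n is even, so [Theta], and hence z, preserves the initial
    segment of length n. *)
Definition supported (n : nat) (z : nat -> nat) : Prop :=
  [/\ fpf_involution z, ~~ odd n & forall x, (n <= x)%N -> z x = Theta x].

Lemma Theta_ge n x : ~~ odd n -> (n <= Theta x)%N = (n <= x)%N.
Proof. by rewrite /Theta; case: ifP; lia. Qed.

Lemma Theta_fpf : fpf_involution Theta.
Proof. by split=> x; rewrite /Theta; case: (boolP (odd x)) => h; try case: ifP; lia. Qed.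

Lemma supported_lt n z x : supported n z -> (x < n)%N -> (z x < n)%N.
Proof.
move=> [[zK _] en hz] xn; case: (ltnP (z x) n) => // h.
have := hz _ h; rewrite zK => e; have := Theta_ge (z x) en.
by rewrite -e; lia.
Qed.

Lemma conj_supported n z i j : (i < n)%N -> (j < n)%N -> supported n z ->
  supported n (conj_by (transp i j) z).
Proof.
move=> hi hj hz; case: (hz) => fz en zn; split=> //; first exact: conj_fpf.
move=> x nx; rewrite /conj_by /= (@transpN i j x); [|lia|lia].
have := Theta_ge x en; rewrite nx zn // => h.
by apply: transpN; lia.
Qed.

Lemma IFPF_supported z : IFPF z <-> (exists w w' : nat -> nat, [/\ cancel w w', cancel w' w,
   exists N, forall x, (N <= x)%N -> w x = x & z = w' \o Theta \o w]).
Proof.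
split=> -[w [w' [h1 h2 h3 h4]]]; exists w, w'; split=> //.
- move/finite_seqP: h3 => [r hr]; exists (\max_(x <- r) x).+1 => x hx.
  apply/eqP; apply: contraTT hx => xw; rewrite -leqNgt.
  have xr : x \in r by have : [set` r]%classic x by rewrite -hr.
  by rewrite (@leq_bigmax_seq _ r xpredT id).

- exact/funext.
- case: h3 => N hN; apply: (sub_finite_set _ (finite_II N)) => x /= /eqP xw.
  by rewrite ltnNge; apply/negP => /hN.
by move=> x; rewrite h4.
Qed.

Lemma IFPF_conj z i j : IFPF z -> IFPF (conj_by (transp i j) z).
Proof.
move=> /IFPF_supported[w [w' [h1 h2 [N hN] ->]]]; apply/IFPF_supported.
exists (w \o transp i j), (transp i j \o w'); split.
- by move=> x /=; rewrite h1 transpK.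
- by move=> x /=; rewrite transpK h2.
- exists (N + i + j).+1 => x hx /=; rewrite transpN; [|lia|lia].
  by apply: hN; lia.
by [].
Qed.

Lemma IFPF_Theta : IFPF Theta.
Proof. by apply/IFPF_supported; exists id, id; split=> //; exists 0%N. Qed.

Lemma IFPF_large z : IFPF z -> exists N, forall n, (N <= n)%N -> ~~ odd n ->
  supported n z.
Proof.
move=> /IFPF_supported[w [w' [h1 h2 [N hN] ->]]]; exists N => n Nn en.
have w'N x : (N <= x)%N -> w' x = x by move=> hx; rewrite -{1}(hN x hx) h1.
have [TK TN] := Theta_fpf.
split=> //.
  split=> x /=; first by rewrite h2 TK h1.
  by move=> /(congr1 w); rewrite h2; apply: TN.
move=> x nx /=; rewrite hN; last by lia.
by apply: w'N; have := Theta_ge x en; rewrite nx; lia.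
Qed.

Definition nested (z : nat -> nat) (p : nat * nat) : bool :=
  (z p.2 < z p.1)%N && (z p.2 < p.1 < p.2)%N.

Lemma ellFPF_sum n z : supported n z ->
  ellFPF z = (\sum_(0 <= x < n) \sum_(0 <= y < n)
    ((z y < z x) && (z y < x < y)))%N.
Proof.
move=> hz; have [[zK zN] en zn] := hz.
pose s := [seq p <- [seq (x, y) | x <- index_iota 0 n, y <- index_iota 0 n] | nested z p].
have memS p : p \in s = nested z p.
  rewrite mem_filter; case: (boolP (nested z p)) => //= /andP[h1 /andP[h2 h3]].
  have p2 : (p.2 < n)%N.
    case: (ltnP p.2 n) => // h; move: h2; rewrite zn // /Theta.
    by case: ifP; lia.
  by case: p {h1} p2 h2 h3 => x y /= *; apply/allpairsP; exists (x, y);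
    rewrite !mem_index_iota; split=> //=; lia.
have us : uniq s.
  rewrite filter_uniq // allpairs_uniq ?iota_uniq //.
  by move=> [a b] [c d].
have fin : finite_set (fpf_inversions z).
  apply/finite_seqP; exists s; apply/seteqP; split=> p /=.
    by rewrite memS => -[h1 h2]; apply/andP.
  by rewrite memS => /andP[].
transitivity (size s).
  apply/perm_size/uniq_perm => // p; rewrite memS.
  have -> : (p \in enum_fset (fset_set (fpf_inversions z))) =
    (p \in fset_set (fpf_inversions z)) by [].
  rewrite in_fset_set //; apply/idP/idP; rewrite inE.
    by move=> [h1 h2]; apply/andP.
  by move=> /andP[].
rewrite size_filter -sum1_count big_mkcond big_allpairs_dep /=.
by apply: eq_bigr => x _; apply: eq_bigr => y _; rewrite /nested /=; case: ifP.
Qed.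

(** Sort the inversions x < y by comparing z y with x. Those with z y < x are counted by [ellFPF].
    Those with z y = x are the n/2 arcs. Those with z y > x correspond to the first kind under (x,
    y) -> (z y, z x). *)
Lemma inversions_ell n z : supported n z ->
  (2 * inversions n z = 4 * ellFPF z + n)%N.
Proof.
move=> hz; have [[zK zN] en zn] := hz; rewrite (ellFPF_sum hz).
have zin : injective z := can_inj zK.
have zlt x : (x < n)%N -> (z x < n)%N by apply: supported_lt.
set L := (\sum_(0 <= x < n) _)%N.
pose C := (\sum_(0 <= x < n) (x < z x))%N.
have hC : (2 * C = n)%N.
  have e : C = (\sum_(0 <= x < n) (z x < x))%N.
    by rewrite /C -(sum_reindex _ zin zlt); apply: eq_bigr => x _; rewrite zK.
  rewrite mul2n -addnn {2}e /C -big_split /=.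
  rewrite (eq_bigr (fun=> 1%N)) ?sum_nat_const_nat ?subn0 ?muln1 // => x _.
  by have := zN x; lia.
suff : inversions n z = (L + C + L)%N by move: hC; clear; lia.
have e2 : L = (\sum_(0 <= x < n) \sum_(0 <= y < n)
    [&& x < y, z y < z x & x < z y])%N.
  rewrite /L exchange_big /= -(sum_reindex _ zin zlt); apply: eq_bigr => x _.
  rewrite -(sum_reindex _ zin zlt); apply: eq_bigr => y _.
  by rewrite !zK; congr nat_of_bool; clear; lia.
have e3 : C = (\sum_(0 <= x < n) \sum_(0 <= y < n)
    [&& x < y, z y < z x & z y == x])%N.
  rewrite /C; apply: eq_big_nat => x /andP[_ xn].
  rewrite (bigD1_seq (z x)) ?iota_uniq ?mem_index_iota ?zlt //= big1 ?addn0.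
    by rewrite zK eqxx andbT andbb.
  move=> y /eqP yx; have : z y <> x by move=> h; apply: yx; rewrite -h zK.
  by clear; lia.
rewrite {2}e2 e3 /L /inversions -!big_split /=; apply: eq_bigr => x _.
rewrite -!big_split /=; apply: eq_bigr => y _.
by clear; lia.
Qed.

                                                                                 
                                
(** Apply [inversions_transp] once on each side. In between, pass to the inverse of z composed with
    the transposition, which keeps the number of inversions. *)
Lemma inversions_conj n z i j : supported n z -> (i < j < n)%N -> z i <> j ->
  (z i < z j)%N ->
  inversions n (conj_by (transp i j) z) = (inversions n z + 2 +
    2 * between n z i j + 2 * between n (transp i j \o z) i j)%N.
Proof.
move=> hz ijn zij lt; have [[zK zN] en zn] := hz.
have [hi hj] : (i < n)%N /\ (j < n)%N by lia.
have zi : injective z := can_inj zK.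
have zji : z j <> i by move=> h; apply: zij; rewrite -h zK.
have e1 := inversions_transp zi ijn lt.
have tzi : injective (transp i j \o z) by apply: inj_comp => //; apply: can_inj (transpK i j).
have lt2 : ((transp i j \o z) i < (transp i j \o z) j)%N.
  by rewrite /= !transpN.
have e2 := inversions_transp tzi ijn lt2.
have e3 : inversions n (transp i j \o z) = inversions n (z \o transp i j).
  apply: inversions_inv.
  - by move=> x /=; rewrite zK transpK.
  - by move=> x /=; rewrite transpK zK.
  - by move=> x xn /=; apply: transp_lt => //; apply: supported_lt.
have -> : conj_by (transp i j) z = (transp i j \o z) \o transp i j by [].
by rewrite e2 e3 e1; lia.
Qed.

(** With [inversions_ell], an ascending conjugation raises the length by 1 plus the two [between]
    counts. A descending one lowers it. *)
Lemma fpf_cover_between n z i j : supported n z -> (i < j < n)%N -> z i <> j ->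
  fpf_cover z (conj_by (transp i j) z) <->
  (z i < z j)%N /\ between n z i j = 0%N /\ between n (transp i j \o z) i j = 0%N.
Proof.
move=> hz ijn zij; have [hi hj] : (i < n)%N /\ (j < n)%N by lia.
have [[zK zN] _ _] := hz; have hz' := conj_supported hi hj hz.
have I1 := inversions_ell hz; have I2 := inversions_ell hz'.
case: (ltnP (z i) (z j)) => lt.
  have e := inversions_conj hz ijn zij lt; split.
    by case=> h _; do !split=> //; clear -e I1 I2 h; lia.
  case=> _ [h1 h2]; split; first by clear -e I1 I2 h1 h2; lia.
  by exists i, j; split=> //; clear -ijn; lia.
split=> [[h _]|[]//]; exfalso.
have zji : z j <> i by move=> h'; apply: zij; rewrite -h' zK.
have E1 : conj_by (transp i j) z i = z j.
  by rewrite /conj_by /= transpL transpN //; apply: zN.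
have E2 : conj_by (transp i j) z j = z i.
  by rewrite /conj_by /= transpR transpN //; apply: zN.
have ij : i <> j by lia.
have ne : z i <> z j by move/(can_inj zK).
have := inversions_conj hz' ijn; rewrite E1 E2 conj_byK.
by move=> /(_ (zN j)) H; have := H ltac:(lia); clear -I1 I2 h; lia.
Qed.

                                                                               
                                               
(** The second [between] count differs from the first only at e = v i, whose value becomes j. This
    point yields the clause excluding i < v i < j. *)
Lemma fpf_cover_left n v j i : supported n v -> (j < n)%N -> (j < v j)%N ->
  (i < j)%N /\ fpf_cover v (conj_by (transp i j) v) <-> cover_cond true v j i.
Proof.
move=> hv jn jk; have [[zK zN] _ _] := hv.
have main : (i < j)%N -> fpf_cover v (conj_by (transp i j) v) <-> cover_cond true v j i.
  move=> ij; have vij : v i <> j by move=> h; have := zK i; rewrite h; lia.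
  have vji : v j <> i by move=> h; apply: vij; rewrite -h zK.
  have [t1 t2] : transp i j (v i) = v i /\ transp i j (v j) = v j.
    by split; apply: transpN => //; apply: zN.
  rewrite (fpf_cover_between hv) ?ij //=.
  rewrite !between_eq0 ?(ltnW jn) //; split.
    move=> [lt [h1 h2]]; split=> //=.
      move=> [h3 h4]; have := h2 (v i); rewrite /= t1 t2 zK transpL h3 h4 => /(_ isT).
      by clear -h3 h4 jk; lia.
    by move=> e e1 e2 e3 e4; have := h1 e; rewrite e1 e2 e3 e4 => /(_ isT).
  move=> [/= _ lt h3 h4]; split=> //; split=> e /andP[e1 e2].
    by apply/negP => /andP[e3 e4]; apply: (h4 e).
  case: (eqVneq (v e) i) => [ei|/eqP ei].
    by case: h3; rewrite -ei zK ei.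
  case: (eqVneq (v e) j) => [ej|/eqP ej].
    by have := zK e; rewrite ej; clear - e2 jk; lia.
  by rewrite /= t1 t2 transpN //; apply/negP => /andP[e3 e4]; apply: (h4 e).
split=> [[ij /(main ij)]//|c]; have ij : (i < j)%N by case: c.
by split=> //; apply/main.
Qed.

Lemma fpf_cover_right n v k l : supported n v -> (l < n)%N -> (v k < k)%N ->
  (k < l)%N /\ fpf_cover v (conj_by (transp k l) v) <-> cover_cond false v k l.
Proof.
move=> hv ln jk; have [[zK zN] _ _] := hv.
have main : (k < l)%N -> fpf_cover v (conj_by (transp k l) v) <-> cover_cond false v k l.
  move=> kl; have vkl : v k <> l by clear -jk kl; lia.
  have vlk : v l <> k by move=> h; apply: vkl; rewrite -h zK.
  have [t1 t2] : transp k l (v k) = v k /\ transp k l (v l) = v l.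
    by split; apply: transpN => //; apply: zN.
  rewrite (fpf_cover_between hv) ?kl //=.
  rewrite !between_eq0 ?(ltnW ln) //; split.
    move=> [lt [h1 h2]]; split=> //=.
      move=> [h3 h4]; have := h2 (v l); rewrite /= t1 t2 zK transpR h3 h4 => /(_ isT).
      by clear -h3 h4 jk; lia.
    by move=> e e1 e2 e3 e4; have := h1 e; rewrite e1 e2 e3 e4 => /(_ isT).
  move=> [/= _ lt h3 h4]; split=> //; split=> e /andP[e1 e2].
    by apply/negP => /andP[e3 e4]; apply: (h4 e).
  case: (eqVneq (v e) l) => [el|/eqP el].
    by case: h3; rewrite -el zK el.
  case: (eqVneq (v e) k) => [ek|/eqP ek].
    by have := zK e; rewrite ek; clear - e1 jk; lia.
  by rewrite /= t1 t2 transpN //; apply/negP => /andP[e3 e4]; apply: (h4 e).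
split=> [[kl /(main kl)]//|c]; have kl : (k < l)%N by case: c.
by split=> //; apply/main.
Qed.

Lemma decreasing_wrev n z : supported n z ->
  (forall i, (i.+1 < n)%N -> (z i.+1 < z i)%N) -> z = wrev n.
Proof.
move=> hz hd; have [_ _ zn] := hz.
have up i : (i < n)%N -> (z i + i < n)%N.
  elim: i => [|i IH] hi; first by rewrite addn0; apply: supported_lt.
  by have := IH (ltnW hi); have := hd i hi; clear; lia.
have dn m i : (i + m.+1 = n)%N -> (m <= z i)%N.
  elim: m i => // m IH i e; have := IH i.+1; have := hd i.
  by move: e; clear; lia.
apply/funext => x; rewrite /wrev; case: ltnP => hx; last exact: zn.
by have := up x hx; have := dn (n - x.+1)%N x; move: hx; clear; lia.
Qed.

Lemma inversions_ascent n z i : supported n z -> (i.+1 < n)%N -> (z i < z i.+1)%N ->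
  (inversions n z < inversions n (conj_by (transp i i.+1) z))%N.
Proof.
move=> hz hi lt; have [[zK _] _ _] := hz.
rewrite inversions_conj ?ltnSn //; first by lia.
by move=> h; have := zK i; rewrite h; lia.
Qed.

Lemma inversions_le n z : (inversions n z <= n * n)%N.
Proof.
have -> : (n * n = \sum_(0 <= x < n) \sum_(0 <= y < n) 1)%N.
  by rewrite !sum_nat_const_nat !subn0 muln1.
by apply: leq_sum => x _; apply: leq_sum => y _; case: (_ && _).
Qed.

(** An involution supported on the segment and without ascent there is [wrev n]. Otherwise
    conjugating at an ascent increases the inversions, whose number is bounded by n^2. *)
Lemma supported_ind n (P : (nat -> nat) -> Prop) : P (wrev n) ->
  (forall z i, supported n z -> (i.+1 < n)%N -> (z i < z i.+1)%N ->
     P (conj_by (transp i i.+1) z) -> P z) ->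
  forall z, supported n z -> P z.
Proof.
move=> h0 hS z; have [m] := ubnP (n * n - inversions n z)%N.
elim: m z => // m IH z hm hz.
case: (pselect (exists i, (i.+1 < n)%N /\ (z i < z i.+1)%N)) => [[i [hi lt]]|no].
  apply: (hS z i) => //; apply: IH; last by apply: conj_supported => //; lia.
  have := inversions_ascent hz hi lt.
  by have := inversions_le n (conj_by (transp i i.+1) z); move: hm; clear; lia.
rewrite (decreasing_wrev hz) // => i hi; case: (ltnP (z i.+1) (z i)) => // h.
have [[zK _] _ _] := hz; have ne : z i <> z i.+1 by move/(can_inj zK); lia.
by case: no; exists i; split=> //; lia.
Qed.

Lemma supported_Theta n : ~~ odd n -> supported n Theta.
Proof. by move=> en; split=> //; apply: Theta_fpf. Qed.

Lemma IFPF_wrev n : ~~ odd n -> IFPF (wrev n).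
Proof.
move=> en; apply: (@supported_ind n (fun z => IFPF z -> IFPF (wrev n)) _ _ Theta) => //.
- by move=> z i _ _ _ h /(IFPF_conj i i.+1).
- exact: supported_Theta.
exact: IFPF_Theta.
Qed.

Lemma supported_wrev n : ~~ odd n -> supported n (wrev n).
Proof.
move=> en; have [TK TN] := Theta_fpf; split=> //; last first.
  by move=> x nx; rewrite /wrev ltnNge nx.
split=> x; rewrite /wrev; case: (ltnP x n) => hx.
- by case: ltnP; lia.
- by rewrite ltnNge Theta_ge // hx /= TK.
- by lia.
exact: TN.
Qed.

                                

(** * Products of pair factors over a set of index pairs *)

Section PairProducts.
Variable V : variable_ring.
Local Notation X := (@X V).
Implicit Types (Q : nat -> nat -> bool).

(** The multiplicative formal group sum of the two variables: 1 + beta times it is (1 + beta x_a)(1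
    + beta x_c). *)
Definition pair_factor a c : V := X a + X c + vbeta * (X a * X c).

Lemma pair_factorC a c : pair_factor a c = pair_factor c a.
Proof. by rewrite /pair_factor [X a + _]addrC [X a * _]mulrC. Qed.

Lemma sw_pair_factor i a c :
  sw i (pair_factor a c) = pair_factor (transp i i.+1 a) (transp i i.+1 c).
Proof. by rewrite /pair_factor !(swD, swM, sw_beta, swX). Qed.

Definition pair_term Q a c : V :=
  if (a < c)%N && Q a c then pair_factor a c else 1.

Definition pair_prod n Q : V :=
  \prod_(0 <= a < n) \prod_(0 <= c < n) pair_term Q a c.

Lemma eq_pair_prod n Q Q' :
  (forall a c, (a < c < n)%N -> Q a c = Q' a c) -> pair_prod n Q = pair_prod n Q'.
Proof.
move=> h; apply: eq_big_nat => a an; apply: eq_big_nat => c /andP[_ cn].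
rewrite /pair_term; case: (ltnP a c) => //= ac.
by rewrite h // ac cn.
Qed.

Lemma prod_bigD2 n i j (H : nat -> V) : (i < n)%N -> (j < n)%N -> i <> j ->
  \prod_(0 <= x < n) H x =
  H i * (H j * \prod_(0 <= x < n | (x != i) && (x != j)) H x).
Proof.
move=> hi hj ij; rewrite (bigD1_seq i) ?iota_uniq ?mem_index_iota //=.
congr (_ * _); rewrite -big_filter.
rewrite (bigD1_seq j) ?filter_uniq ?iota_uniq ?mem_filter ?mem_index_iota //=.
  by rewrite big_filter_cond.
by rewrite hj andbT; apply/eqP; apply: nesym.
Qed.

Lemma sw_prod i n (H : nat -> V) P :
  sw i (\prod_(0 <= a < n | P a) H a) = \prod_(0 <= a < n | P a) sw i (H a).
Proof. exact: (big_morph _ (@swM V i) (sw1 V i)). Qed.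

Lemma sw_pair_prod i n Q : (i.+1 < n)%N -> (forall a c, Q a c = Q c a) ->
  (forall x, (x < n)%N -> x <> i -> x <> i.+1 -> Q i x = Q i.+1 x) ->
  sw i (pair_prod n Q) = pair_prod n Q.
Proof.
move=> hi Qsym Qi; have hi' := ltnW hi; have ne : i <> i.+1 by lia.
rewrite /pair_prod sw_prod.
under eq_bigr => a _ do rewrite sw_prod.
have split2 (h : nat -> nat -> V) :
    \prod_(0 <= x < n) \prod_(0 <= y < n) h x y =
    (h i i * h i i.+1 * h i.+1 i * h i.+1 i.+1)
    * (\prod_(0 <= x < n | (x != i) && (x != i.+1))
         (h i x * h i.+1 x * (h x i * h x i.+1)))
    * \prod_(0 <= x < n | (x != i) && (x != i.+1))
        \prod_(0 <= y < n | (y != i) && (y != i.+1)) h x y.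
  rewrite (prod_bigD2 _ hi' hi ne) !(prod_bigD2 (h _) hi' hi ne).
  under [X in _ * (_ * X) = _]eq_bigr => x _ do rewrite (prod_bigD2 _ hi' hi ne).
  by rewrite !big_split /=; ring.
rewrite !split2; congr (_ * _ * _).
- rewrite /pair_term !ltnn ltnSn (ltnNge i.+1) leqnSn /= !sw1.
  by case: ifP; rewrite ?sw1 // sw_pair_factor transpL transpR pair_factorC.
- rewrite big_nat_cond [RHS]big_nat_cond.
  apply: eq_bigr => x /andP[/andP[_ xn] /andP[/eqP xi /eqP xi']].
  have E := Qi x xn xi xi'; have e : (x < i.+1)%N = (x < i)%N by lia.
  have e' : (i.+1 < x)%N = (i < x)%N by lia.
  rewrite /pair_term !(Qsym x) E e e'.
  case: ifP => _; case: ifP => _;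
    rewrite ?sw1 ?sw_pair_factor ?transpL ?transpR ?(transpN xi xi'); ring.
apply: eq_bigr => x /andP[/eqP xi /eqP xi']; apply: eq_bigr => y /andP[/eqP yi /eqP yi'].
by rewrite /pair_term; case: ifP; rewrite ?sw1 // sw_pair_factor !transpN.
Qed.

Lemma pair_prod_factor n Q Q' c d : (c < d < n)%N -> Q' c d = false ->
  (forall a e, (a < e < n)%N -> Q a e = (a == c) && (e == d) || Q' a e) ->
  pair_prod n Q = pair_factor c d * pair_prod n Q'.
Proof.
move=> /andP[cd dn] Qcd hQ; have cn := ltn_trans cd dn.
have E a e : (a < n)%N -> (e < n)%N -> ~~ ((a == c) && (e == d)) ->
    pair_term Q a e = pair_term Q' a e.
  move=> an en h; rewrite /pair_term; case: (ltnP a e) => //= ae.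
  by rewrite hQ ?ae // (negPf h).
rewrite /pair_prod (bigD1_seq c) ?iota_uniq ?mem_index_iota //=.
rewrite [in RHS](bigD1_seq c) ?iota_uniq ?mem_index_iota //=.
rewrite (bigD1_seq d) ?iota_uniq ?mem_index_iota //=.
rewrite [in RHS](bigD1_seq d) ?iota_uniq ?mem_index_iota //=.
have -> : pair_term Q c d = pair_factor c d.
  by rewrite /pair_term cd hQ ?cd // !eqxx.
have -> : pair_term Q' c d = 1 by rewrite /pair_term Qcd andbF.
rewrite mul1r !mulrA; congr (_ * _ * _).
  rewrite big_nat_cond [RHS]big_nat_cond; apply: eq_bigr => e /andP[/andP[_ en] ed].
  by apply: E; rewrite // eqxx.
rewrite big_nat_cond [RHS]big_nat_cond; apply: eq_bigr => a /andP[/andP[_ an] ac].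
apply: eq_big_nat => e /andP[_ en].
by apply: E; rewrite // (negPf ac).
Qed.

Lemma pair_prod_widen n N Q : (n <= N)%N ->
  (forall a c, (a < c)%N -> Q a c -> (c < n)%N) -> pair_prod N Q = pair_prod n Q.
Proof.
move=> nN hQ; have one a c : ~~ ((a < n) && (c < n))%N -> pair_term Q a c = 1.
  move=> h; rewrite /pair_term; case: ifP => // /andP[ac Qac].
  by have := hQ _ _ ac Qac; move: h ac; clear; lia.
rewrite /pair_prod (big_cat_nat (leq0n n) nN) /= [X in _ * X]big_nat_cond.
rewrite [X in _ * X]big1 ?mulr1; last first.
  move=> a /andP[/andP[na _] _]; rewrite big1 // => c _; apply: one.
  by rewrite ltnNge na.
apply: eq_bigr => a _; rewrite (big_cat_nat (leq0n n) nN) /=.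
rewrite [X in _ * X]big_nat_cond [X in _ * X]big1 ?mulr1 // => c /andP[/andP[nc _] _].
by apply: one; rewrite [(c < n)%N]ltnNge nc andbF.
Qed.

End PairProducts.

(** * Symmetry of G at ascents and at short arcs *)

Record grothendieck_family (V : variable_ring) (G : (nat -> nat) -> V) : Prop := {
  G_top : forall n, (0 < n)%N -> ~~ odd n ->
    G (wrev n) = pair_prod V n (fun a c => a + c + 2 <= n)%N;
  G_step : forall z i, IFPF z -> z i <> i.+1 -> (z i.+1 < z i)%N -> z i.+1 <> i ->
    bdivdiff i (G z) (G (conj_by (transp i i.+1) z))
}.

Section Symmetry.
Variables (V : variable_ring) (G : (nat -> nat) -> V).
Hypothesis hG : grothendieck_family G.

Lemma conj_ascent z i : fpf_involution z -> (z i < z i.+1)%N ->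
  [/\ conj_by (transp i i.+1) z i = z i.+1, conj_by (transp i i.+1) z i.+1 = z i,
      z i <> i.+1, z i.+1 <> i
    & forall x, x <> i -> x <> i.+1 -> z x <> i -> z x <> i.+1 ->
        conj_by (transp i i.+1) z x = z x].
Proof.
move=> [zK zN] lt.
have ne : z i <> i.+1 by move=> e; have := zK i; rewrite e; lia.
have ne' : z i.+1 <> i by move=> e; have := zK i.+1; rewrite e.
have [n1 n2] := (zN i, zN i.+1).
rewrite /conj_by /=; split=> //.
- by rewrite transpL transpN.
- by rewrite transpR transpN.
by move=> x *; rewrite (@transpN i i.+1 x) ?transpN.
Qed.

Lemma G_ascent z i : fpf_involution z -> IFPF z -> (z i < z i.+1)%N ->
  bdivdiff i (G (conj_by (transp i i.+1) z)) (G z).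
Proof.
move=> fz hz lt; have [e1 e2 ne ne' _] := conj_ascent fz lt.
have := G_step hG (i := i) (IFPF_conj i i.+1 hz); rewrite e1 e2 conj_byK.
by apply=> // h; case: fz => zK zN; [apply: (zN i.+1) | apply: (zN i)].
Qed.

Lemma G_ascent_sym z i : fpf_involution z -> IFPF z -> (z i < z i.+1)%N ->
  sw i (G z) = G z.
Proof. by move=> fz hz lt; apply: bdivdiff_image (G_ascent fz hz lt). Qed.

(** Descending induction on the number of inversions, by the position of an ascent a of z relative
    to the arc. A neighbouring ascent is treated with the braid lemmas, a distant one by
    commutation. *)
Lemma G_arc_sym n z i : supported n z -> IFPF z -> (i.+1 < n)%N -> z i = i.+1 ->
  sw i (G z) = G z.
Proof.
move=> sz; have [m] := ubnP (n * n - inversions n z)%N.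
elim: m z i sz => // m IH z i sz hm hz hi zi.
have [[zK zN] en zn] := sz.
case: (pselect (exists a, (a.+1 < n)%N /\ (z a < z a.+1)%N)); last first.
  move=> no; have zE : z = wrev n.
    apply: decreasing_wrev => // a ha; case: (ltnP (z a.+1) (z a)) => // h.
    have ne : z a <> z a.+1 by move/(can_inj zK); lia.
    by case: no; exists a; split=> //; lia.
  have n0 : (0 < n)%N by lia.
  rewrite zE (G_top hG n0 en).
  (* An arc of the reversal joining i and i+1 is central, so n = 2(i+1). For any third index x, the
     pairs of x with i and with i+1 are then both present or both absent in the product. *)
  move: zi; rewrite zE /wrev (ltnW hi) => nE.
  apply: sw_pair_prod => // [a c|x xn xi xi']; first by rewrite [(a + c)%N]addnC.
  by lia.
move=> [a [ha lt]].
have inv_lt y b : supported n y -> (n * n - inversions n y < m.+1)%N ->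
    (b.+1 < n)%N -> (y b < y b.+1)%N ->
    (n * n - inversions n (conj_by (transp b b.+1) y) < m)%N.
  move=> sy hy hb lt'; have := inversions_ascent sy hb lt'.
  by have := inversions_le n (conj_by (transp b b.+1) y); clear -hy; lia.
set z1 := conj_by (transp a a.+1) z.
have s1 : supported n z1 by apply: conj_supported => //; lia.
have fz : fpf_involution z by [].
have fz1 : fpf_involution z1 by apply: conj_fpf.
have hz1 : IFPF z1 by apply: IFPF_conj.
have [e1 e2 ne1 ne2 ex] := conj_ascent fz lt; rewrite -/z1 in e1 e2 ex.
have b1 : bdivdiff a (G z1) (G z) := G_ascent fz hz lt.
have l1 := inv_lt _ _ sz hm ha lt; rewrite -/z1 in l1.
have zi' : z i.+1 = i by rewrite -zi zK.
case: (eqVneq a i) => [ai|/eqP ai]; first by move: lt; rewrite ai zi zi'; lia.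
case: (eqVneq a i.+1) => [ai'|/eqP ai'].
                                                                                
  (* Ascent just to the right of the arc: two ascending conjugations carry the arc to i+1, i+2,
     where the induction hypothesis gives the symmetry that [bdivdiff_braid_symL] brings back to
     i. *)
  rewrite ai' in lt e1 e2 ex b1 ha ne1 ne2.
  have z1i : z1 i = i.+2.
    by rewrite /z1 ai' /conj_by /= (@transpN i.+1 i.+2 i) ?zi ?transpL //; lia.
  have c2 : (i.+2 < z i.+2)%N.
    have := zN i.+2; move: lt; rewrite zi'.
    have : z i.+2 <> i.+1 by move=> h; have := zK i.+2; rewrite h zi'; lia.
    by clear; lia.
  have lt1 : (z1 i < z1 i.+1)%N by rewrite z1i e1.
  set z2 := conj_by (transp i i.+1) z1.
  have s2 : supported n z2 by apply: conj_supported => //; lia.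
  have b2 : bdivdiff i (G z2) (G z1) := G_ascent fz1 hz1 lt1.
  have [f1 f2 _ _ _] := conj_ascent fz1 lt1; rewrite -/z2 in f1 f2.
  apply: bdivdiff_braid_symL b2 b1.
  apply: IH => //; [|exact: IFPF_conj | by rewrite f2].
  exact: (inv_lt _ _ s1 (ltnW l1) hi lt1).
case: (eqVneq a.+1 i) => [ai''|/eqP ai''].
  (* Ascent just to the left: two conjugations carry the arc to a, a+1, and [bdivdiff_braid_symR]
     brings the symmetry back. *)
  subst i; have z1i : z1 a.+2 = a.
    by rewrite /z1 /conj_by /= (@transpN a a.+1 a.+2) ?zi' ?transpR //; lia.
  have c2 : (z a < a)%N.
    have := zN a; move: lt; rewrite zi.
    have : z a <> a.+1 by move=> h; have := zK a; rewrite h zi; lia.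
    by clear; lia.
  have lt1 : (z1 a.+1 < z1 a.+2)%N by rewrite z1i e2.
  set z2 := conj_by (transp a.+1 a.+2) z1.
  have s2 : supported n z2 by apply: conj_supported => //; lia.
  have b2 : bdivdiff a.+1 (G z2) (G z1) := G_ascent fz1 hz1 lt1.
  have [f1 f2 _ _ fx] := conj_ascent fz1 lt1; rewrite -/z2 in f1 f2 fx.
  apply: bdivdiff_braid_symR b2 b1.
  apply: IH => //; [|exact: IFPF_conj|].
    exact: (inv_lt _ _ s1 (ltnW l1) hi lt1).
  have [z2K _] : fpf_involution z2 by apply: conj_fpf.
  by rewrite z1i in f1; have := z2K a.+1; rewrite f1.
(* Distant ascent: s_i commutes with s_a and fixes x_a - x_{a+1}, so the symmetry of G z1 passes to
   its divided difference G z. *)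
have far : sw i (G z1) = G z1.
  apply: IH => //; rewrite ex ?zi //; try lia.
have cf f : sw i (sw a f) = sw a (sw i f).
  case: (ltnP i a) => h; first by apply: sw_far; lia.
  by symmetry; apply: sw_far; lia.
have si x : x <> i -> x <> i.+1 -> sw i (X x) = X x :> V by move=> *; apply: sw_X_out.
have ai3 : a.+1 <> i.+1 by lia.
move/bdivdiffE: (b1) => E; have E2 := congr1 (sw i) E.
rewrite !(swD, swN, swM, sw1, sw_beta) !si // cf far in E2.
by apply: (@XB_cancel V a); rewrite E2 E.
Qed.
End Symmetry.

(** * The base identity, by stripping factors from the next reversal *)

Section BaseCase.
Variables (V : variable_ring) (G : (nat -> nat) -> V).
Hypothesis hG : grothendieck_family G.

Definition pair_state N (Q : nat -> nat -> bool) (z : nat -> nat) : Prop :=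
  [/\ supported N z, IFPF z & G z = pair_prod V N Q].

(** A divided difference at c removes one factor pairing c with d, by [bdivdiff_factor], as soon as
    the remaining product is symmetric in x_c and x_{c+1}. *)
Lemma pair_state_drop N (Q Q' : nat -> nat -> bool) z c d : pair_state N Q z ->
  (c.+1 < N)%N -> (z c.+1 < z c)%N -> z c.+1 <> c -> d <> c -> d <> c.+1 ->
  pair_prod V N Q = pair_factor V c d * pair_prod V N Q' ->
  (forall a e, Q' a e = Q' e a) ->
  (forall x, (x < N)%N -> x <> c -> x <> c.+1 -> Q' c x = Q' c.+1 x) ->
  pair_state N Q' (conj_by (transp c c.+1) z).
Proof.
move=> [sz hz Gz] cN lt ne dc dc' E Qs Qi; split.
- by apply: conj_supported => //; apply: ltnW.
- exact: IFPF_conj.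
have [[zK zN] _ _] := sz.
have b1 : bdivdiff c (G z) (G (conj_by (transp c c.+1) z)).
  by apply: (G_step hG) => // h; apply: ne; rewrite -h zK.
apply: (bdivdiff_uniq b1); rewrite Gz E /pair_factor.
apply: bdivdiff_factor; first exact: sw_X_out.
exact: sw_pair_prod.
Qed.

Lemma conj_descent z i : fpf_involution z -> z i.+1 <> i ->
  [/\ conj_by (transp i i.+1) z i = z i.+1, conj_by (transp i i.+1) z i.+1 = z i
    & forall x, x <> i -> x <> i.+1 -> z x <> i -> z x <> i.+1 ->
        conj_by (transp i i.+1) z x = z x].
Proof.
move=> [zK zN] ne; have [n1 n2] := (zN i, zN i.+1).
have ne' : z i <> i.+1 by move=> e; have := zK i; rewrite e.
rewrite /conj_by /=; split=> //.
- by rewrite transpL transpN.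
- by rewrite transpR transpN.
by move=> x *; rewrite (@transpN i i.+1 x) ?transpN.
Qed.

Variables (m : nat) (j : nat).
Hypothesis jm : (j < m)%N.
Local Notation n := (2 * m)%N.
Local Notation N := (2 * m + 2)%N.

Let Q1 r a c := ((a + c + 1 <= n) || ((a + c == n) && (r <= minn a c)))%N.
Let Q2 r a c := ((a + c + 2 <= n) || ((a + c + 1 == n) && (minn a c + r < m)))%N.
Let Q3 r a c := ((a + c + 2 <= n) || ((a + c + 1 == n) && (r <= minn a c <= j)))%N.

                                                                               
(** The product for the reversal of length n + 2 contains the pairs with a + c <= n. Descents at 0,
    1, ..., m-1 remove the antidiagonal a + c = n from the outside in, while the partner of n+1
    moves from 0 to m. *)
Lemma stage1 r : (r <= m)%N -> exists z, [/\ pair_state N (Q1 r) z, z r = n.+1,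
  forall a, (a < r)%N -> z a = (n - a)%N
  & forall a, (r < a <= m)%N -> z a = (n.+1 - a)%N].
Proof.
elim: r => [|r IH] hr.
  have eN : ~~ odd N by rewrite addn2 mul2n /= odd_double.
  exists (wrev N); split=> //.
  - split; [exact: supported_wrev | exact: IFPF_wrev |].
    rewrite (G_top hG) //; last by lia.
    apply: eq_pair_prod => a c h.
    by rewrite /Q1; move: h; clear; lia.
  - by rewrite /wrev ifT; lia.
  by move=> a ha; rewrite /wrev ifT; lia.
have [z [hz zr z1 z2]] := IH (ltnW hr).
have zr1 := z2 r.+1; have {}zr1 : z r.+1 = (n - r)%N by rewrite zr1; lia.
exists (conj_by (transp r r.+1) z).
have fz : fpf_involution z by case: hz => [[]].
have [|e1 e2 ex] := @conj_descent z r fz; first by lia.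
split.
- apply: (@pair_state_drop _ _ _ _ r (n - r)%N hz); try lia.
    apply: pair_prod_factor; [lia | by rewrite /Q1; lia |].
    by move=> a e h; rewrite /Q1; move: h hr; clear; lia.
  + by move=> a e; rewrite /Q1; clear; lia.
  by move=> x hx x1 x2; rewrite /Q1; move: hr hx x1 x2; clear; lia.
- by rewrite e2.
- move=> a ha; case: (eqVneq a r) => [->|/eqP ar]; first by rewrite e1.
  have za : z a = (n - a)%N by apply: z1; lia.
  by rewrite ex ?za //; lia.
move=> a ha; have za : z a = (n.+1 - a)%N by apply: z2; lia.
by rewrite ex ?za //; lia.
Qed.

                                                                               
           
(** Descents at m, m+1, ... remove the pairs with a + c = n - 1 from the centre outwards, stopping
    before the pair of j with its partner in [wrev n]. *)
Lemma stage2 r : (r + j < m)%N -> exists z, [/\ pair_state N (Q2 r) z,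
  z (m + r)%N = n.+1, forall a, (a + r < m)%N -> z a = (n - a)%N
  & forall a, (m <= a + r)%N -> (a < m)%N -> z a = (n.-1 - a)%N].
Proof.
elim: r => [|r IH] hr.
  have [z [[sz hz Gz] zr z1 z2]] := stage1 (leqnn m).
  exists z; split; rewrite ?addn0 //.
  - split=> //; rewrite Gz; apply: eq_pair_prod => a c h.
    by rewrite /Q1 /Q2; move: h; clear; lia.
  - by move=> a; rewrite addn0; apply: z1.
  by move=> a; lia.
have [|z [hz zr z1 z2]] := IH; first by lia.
have fz : fpf_involution z by case: hz => [[]].
have zb : z (m - r.+1)%N = (m + r).+1 by rewrite z1; lia.
have zr1 : z (m + r).+1 = (m - r.+1)%N by rewrite -zb (fz.1).
exists (conj_by (transp (m + r) (m + r).+1) z).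
have [|e1 e2 ex] := @conj_descent z (m + r) fz; first by lia.
have fz' := conj_fpf (m + r) (m + r).+1 fz.
split.
- apply: (@pair_state_drop _ _ _ _ (m + r)%N (m - r.+1)%N hz); try lia.
    rewrite pair_factorC; apply: pair_prod_factor; [lia | by rewrite /Q2; lia |].
    by move=> a e h; rewrite /Q2; move: h hr; clear; lia.
  + by move=> a e; rewrite /Q2; clear; lia.
  by move=> x hx x1 x2; rewrite /Q2; move: hr hx x1 x2; clear; lia.
- by rewrite addnS e2.
- move=> a ha; have za : z a = (n - a)%N by apply: z1; lia.
  by rewrite ex ?za //; lia.
move=> a ha am; case: (eqVneq a (m - r.+1)%N) => [->|/eqP ar].
  have e3 := fz'.1 (m + r)%N; rewrite e1 zr1 in e3.
  by rewrite e3; move: hr; clear; lia.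
have za : z a = (n.-1 - a)%N by apply: z2; lia.
by rewrite ex ?za //; lia.
Qed.

                                                                              
                         
(** Descents at 0, ..., j-1 remove the outer pairs of that antidiagonal. At r = j the pair j, n-1-j
    is its only survivor, which is the extra factor in [G_base]. *)
Lemma stage3 r : (r <= j)%N -> exists z, [/\ pair_state N (Q3 r) z,
  z (n.-1 - j)%N = n.+1 /\ z r = n, forall a, (a < r)%N -> z a = (n.-1 - a)%N,
  forall a, (r < a <= j)%N -> z a = (n - a)%N
  & forall a, (j < a < m)%N -> z a = (n.-1 - a)%N].
Proof.
elim: r => [|r IH] hr.
  have [|z [[sz hz Gz] zr z1 z2]] := @stage2 (m.-1 - j)%N; first by lia.
  exists z; split=> //.
  - split=> //; rewrite Gz; apply: eq_pair_prod => a c h.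
    by rewrite /Q2 /Q3; move: h jm; clear; lia.
  - split; last by rewrite z1; lia.
    by rewrite -zr; congr z; lia.
  - by move=> a ha; apply: z1; lia.
  by move=> a ha; apply: z2; lia.
have [|z [hz [zk zr] z1 z2 z3]] := IH; first by lia.
have fz : fpf_involution z by case: hz => [[]].
have zr1 : z r.+1 = (n.-1 - r)%N by rewrite z2; lia.
exists (conj_by (transp r r.+1) z).
have [|e1 e2 ex] := @conj_descent z r fz; first by lia.
split.
- apply: (@pair_state_drop _ _ _ _ r (n.-1 - r)%N hz); try lia.
    apply: pair_prod_factor; [lia | by rewrite /Q3; lia |].
    by move=> a e h; rewrite /Q3; move: h hr jm; clear; lia.
  + by move=> a e; rewrite /Q3; clear; lia.
  by move=> x hx x1 x2; rewrite /Q3; move: hr hx x1 x2 jm; clear; lia.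
- by split; [rewrite ex ?zk //; lia | rewrite e2].
- move=> a ha; case: (eqVneq a r) => [->|/eqP ar]; first by rewrite e1.
  have za : z a = (n.-1 - a)%N by apply: z1; lia.
  by rewrite ex ?za //; lia.
- move=> a ha; have za : z a = (n - a)%N by apply: z2; lia.
  by rewrite ex ?za //; lia.
move=> a ha; have za : z a = (n.-1 - a)%N by apply: z3; lia.
by rewrite ex ?za //; lia.
Qed.

Lemma G_base : let k := (n.-1 - j)%N in
  G (conj_by (transp n k) (wrev n)) = pair_factor V j k * G (wrev n).
Proof.
move=> k; have [z [[sz hz Gz] [zk zj] z1 _ z3]] := stage3 (leqnn j).
have en : ~~ odd n by rewrite mul2n odd_double.
have sw_ := supported_wrev en; have [fw _ _] := sw_.
have wk : wrev n k = j by rewrite /wrev ifT; lia.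
have wn : wrev n n = n.+1 by rewrite /wrev ltnn /Theta (negPf en).
have [||a1 a2 a3 a4 ax] := @conj_swap k (wrev n) n fw; [lia|lia|].
rewrite wk wn in a1 a2 a3 a4.
have [fz _ zT] := sz; have [zK zN] := fz.
have zE : z = conj_by (transp n k) (wrev n).
  have zn : z n = j by rewrite -zj zK.
  have zn1 : z n.+1 = k by rewrite -zk zK.
  have za a : (a < m)%N -> a <> j -> z a = (n.-1 - a)%N.
    by move=> am aj; case: (ltnP a j) => h; [apply: z1 | apply: z3; lia].
  apply/funext => x.
  case: (eqVneq x j) => [->|/eqP xj]; first by rewrite zj a2.
  case: (eqVneq x k) => [->|/eqP xk]; first by rewrite zk a3.
  case: (eqVneq x n) => [->|/eqP xn]; first by rewrite zn a1.
  case: (eqVneq x n.+1) => [->|/eqP xn1]; first by rewrite zn1 a4.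
  rewrite ax //; last by rewrite wk.
    rewrite /wrev; case: (ltnP x n) => hx; last by apply: zT; lia.
    case: (ltnP x m) => xm; first by rewrite za //; lia.
    have e : z (n.-1 - x)%N = x by rewrite za; lia.
    by rewrite -{1}e zK; lia.
  by rewrite wn.
rewrite -zE Gz (G_top hG) //; last by lia.
rewrite (@pair_prod_factor V _ _ (fun a c => a + c + 2 <= n)%N j k).
- by congr (_ * _); apply: pair_prod_widen; [lia | move=> a c; lia].
- by rewrite /k; move: jm; clear; lia.
- by rewrite /k; move: jm; clear; lia.
by move=> a c h; rewrite /Q3 /k; move: h jm; clear; lia.
Qed.
End BaseCase.

                               

(** * The induction proving the identity between chains *)

Lemma exists_left z j : exists2 I, sorted (blt true) I &
  forall a : nat, a \in I <-> cover_cond true z j a.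
Proof.
exists [seq a <- iota 0 j | `[< cover_cond true z j a >]].
  by apply: sorted_filter (@blt_trans true) _ _ (iota_ltn_sorted 0 j).
move=> a; rewrite mem_filter mem_iota add0n /=; split.
  by move=> /andP[/asboolP].
by move=> c; rewrite asboolT //; case: c.
Qed.

(** Beyond the segment z is [Theta], with first arc n, n+1. The point n+1 fails the third clause,
    and n blocks every later point. *)
Lemma cover_cond_right_bound n z k l : supported n z -> (k < n)%N -> (z k < k)%N ->
  cover_cond false z k l -> (l <= n)%N.
Proof.
move=> [_ en zT] kn jk [/= h1 h2 h3 h4]; rewrite leqNgt; apply/negP => nl.
have zn : z n = n.+1 by rewrite zT // /Theta (negPf en).
case: (eqVneq l n.+1) => [ln|/eqP ln].
  have zl : z l = n by rewrite zT ?ln // /Theta /= en.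
  by apply: h3; rewrite zl ln; move: kn; clear; lia.
have zl : (n.+2 <= z l)%N.
  have := @Theta_ge n.+2 l; rewrite -zT; last by lia.
  by move: en nl ln; clear => en nl ln ->; rewrite /= ?negbK //; lia.
by apply: (h4 n) => //; rewrite zn; move: zl kn jk; clear; lia.
Qed.

Lemma exists_right n z k : supported n z -> (k < n)%N -> (z k < k)%N ->
  exists2 L, sorted (blt false) L & forall a : nat, a \in L <-> cover_cond false z k a.
Proof.
move=> sz kn jk; exists [seq a <- rev (iota 0 n.+1) | `[< cover_cond false z k a >]].
  apply: sorted_filter (@blt_trans false) _ _ _.
  by rewrite rev_sorted; apply: iota_ltn_sorted.
move=> a; rewrite mem_filter mem_rev mem_iota add0n /=; split.
  by move=> /andP[/asboolP].
move=> c; rewrite asboolT //= ltnS.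
exact: (cover_cond_right_bound sz kn jk c).
Qed.

Section Main.
Variables (V : variable_ring) (G : (nat -> nat) -> V).
Hypothesis hG : grothendieck_family G.
Local Notation t := (vbeta : V).
Local Notation GV := (G : (nat -> nat) -> V^o).
Local Notation csum := (chain_sum t GV).

(** A descent that is not an arc is the defining recursion. In the other cases G w is symmetric, by
    [G_ascent_sym] or [G_arc_sym], and [bdivdiff_sym] applies. *)
Lemma bdivdiff_demazure b p q w i : IFPF w -> adjacent b p q ->
  i = (if b then p else q) -> bdivdiff i (G w) (demazure t GV b p q w).
Proof.
move=> hw pq ib; have [n0 hn] := IFPF_large hw.
pose n := (2 * (n0 + i + 2))%N.
have sw_ : supported n w.
  by apply: hn; rewrite /n ?mul2n ?odd_double //; clear; lia.
have hi : (i.+1 < n)%N by rewrite /n; clear; lia.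
have [fw _ _] := sw_; have [wK wN] := fw.
have E : demazure t GV b p q w =
    (if (w i.+1 < w i)%N && (w i.+1 != i) then G (conj_by (transp i i.+1) w)
     else - t * G w) :> V.
  rewrite /demazure; move: pq ib; case: b => /= pq ->; subst.
    by [].
  rewrite [transp _ _]transpC; congr (if _ && ~~ _ then _ else _).
  by apply/eqP/eqP => e; [have := wK q | have := wK q.+1]; rewrite e.
rewrite E; case: ifP => [/andP[lt /eqP ne]|h].
  have ne' : w i <> i.+1 by move=> e; have := wK i; rewrite e.
  exact: (G_step hG hw ne' lt ne).
apply: bdivdiff_sym; case: (ltnP (w i) (w i.+1)) => lt.
  exact: (G_ascent_sym hG).
apply: (G_arc_sym hG sw_) => //.
have ne : w i <> w i.+1 by move/(can_inj wK) => e; have := n_Sn i e.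
have lt' : (w i.+1 < w i)%N by move: lt ne; clear; lia.
by move: h; rewrite lt' /= => /negbFE/eqP e; have := wK i.+1; rewrite e.
Qed.

Lemma bdivdiff_chain (H : (nat -> nat) -> V^o) i j I z :
  (forall w, IFPF w -> bdivdiff i (G w) (H w : V)) -> IFPF z ->
  bdivdiff i (csum j I z : V) (chain_sum t H j I z : V).
Proof.
move=> hH; elim: I z => [|a I IH] z hz /=; first exact: hH.
apply: bdivdiffD; [exact: IH | apply: IH; exact: IFPF_conj | exact: sw_beta].
Qed.

Definition transition_at z j : Prop := forall I L,
  sorted (blt true) I -> (forall a : nat, a \in I <-> cover_cond true z j a) ->
  sorted (blt false) L -> (forall a : nat, a \in L <-> cover_cond false z (z j) a) ->
  (1 + t * X j) * (1 + t * X (z j)) * (csum j I z : V) = csum (z j) L z.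

Lemma transition_top m j : (j < m)%N -> transition_at (wrev (2 * m)) j.
Proof.
move=> jm I L sI hI sL hL; have := G_base hG jm; set n := (2 * m)%N => /= E.
have en : ~~ odd n by rewrite /n mul2n odd_double.
have sw_ := supported_wrev en; have [[wK wN] _ _] := sw_.
have wj : wrev n j = (n.-1 - j)%N by rewrite /wrev ifT /n; move: jm; clear; lia.
have wk : wrev n (n.-1 - j)%N = j by rewrite -wj wK.
have wn : wrev n n = n.+1 by rewrite /wrev ltnn /Theta (negPf en).
rewrite wj in hL *; set k := (n.-1 - j)%N in E hL wj wk *.
have kn : (k < n)%N by rewrite /k /n; move: jm; clear; lia.
have jk : (j < k)%N by rewrite /k /n; move: jm; clear; lia.
have -> : I = [::].
  case: I sI hI => // a I _ hI; have [/= aj ak _ _] := (hI a).1 (mem_head _ _).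
  move: ak; rewrite wj /wrev ifT; last by move: aj jk kn; clear; lia.
  by rewrite /k; move: aj jk kn; clear; lia.
(* Between k and n the values of the reversal fall below j, so a cover is at least n. By
   [cover_cond_right_bound] it is at most n. *)
have -> : L = [:: n].
  apply: (@sorted_eq_mem false) => // x; rewrite hL inE; split; last first.
    move=> /eqP->; split=> /=; rewrite ?wn ?wk //.
    + by move: jk kn; clear; lia.
    + by clear; lia.
    move=> e en' ke _; rewrite {1}/wrev en' /k in ke *.
    by move: ke jk kn; rewrite /k; clear; lia.
  move=> c; have := cover_cond_right_bound sw_ kn _ c; rewrite wk => /(_ jk) xn.
  case: c => /= kx jx _ _; rewrite wk in jx; apply/eqP.
  case: (ltnP x n) => h; last by move: xn h; clear; lia.
  by move: jx kx; rewrite /wrev h /k; clear; lia.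
rewrite /= E /pair_factor -[_ *: _]/(_ * _); ring.
Qed.

(** Both sides of the identity for s z s have the same divided difference at i. On each side it is
    computed by the Leibniz rules and by the transition lemmas, according to which endpoint of the
    arc, if any, is i or i+1. *)
Lemma transition_step z i j : fpf_involution z -> IFPF z -> (z i < z i.+1)%N ->
  (j < z j)%N ->
  (exists n, supported n z /\ [&& i.+1 < n & z j < n]%N) ->
  transition_at (conj_by (transp i i.+1) z) (transp i i.+1 j) ->
  transition_at z j.
Proof.
move=> fz hz lt jk [n [sz /andP[iN kn]]] IH I' L' sI' hI' sL' hL'.
have [e1 e2 ne ne' ex] := conj_ascent fz lt.
set z1 := conj_by _ z in IH e1 e2 ex; set s := transp i i.+1 in IH.
have fz1 : fpf_involution z1 by apply: conj_fpf.
have [z1K z1N] := fz1.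
have z1E : conj_by s z1 = z by apply: conj_byK.
set j1 := s j in IH; set k1 := s (z j).
have z1j : z1 j1 = k1 by rewrite /z1 /j1 /conj_by /= transpK.
have z1k : z1 k1 = j1 by rewrite -z1j z1K.
have sj1 : s j1 = j by apply: transpK.
have sk1 : s k1 = z j by apply: transpK.
have jk1 : (j1 < k1)%N.
  have : blt true j1 k1; last by [].
  rewrite /j1 /k1 (@blt_transp true) // /blt jk /=.
  by case: eqP => // ji; case: eqP => // ki; case: ne; rewrite ji in ki.
have sz1 : supported n z1 by apply: conj_supported => //; apply: ltnW.
have kn1 : (k1 < n)%N by apply: transp_lt => //; apply: ltnW.
have hz1 : IFPF z1 by apply: IFPF_conj.
have [I sI hI] := exists_left z1 j1.
have [L sL hL] : exists2 L, sorted (blt false) L &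
    forall a : nat, a \in L <-> cover_cond false z1 k1 a.
  by apply: (exists_right sz1 kn1); rewrite z1k.
have {}IH : (1 + t * X j1) * (1 + t * X k1) * (csum j1 I z1 : V) = csum k1 L z1.
  by rewrite -z1j; apply: IH => //; rewrite z1j.
have zqp : z1 i.+1 <> i by rewrite e2; apply: fz.2.
have zqp' : z1 i <> i.+1 by rewrite e1; apply: fz.2.
have desT : blt true (z1 i.+1) (z1 i) by rewrite e1 e2.
have desF : blt false (z1 i) (z1 i.+1) by rewrite e1 e2.
have adjT : adjacent true i i.+1 by [].
have adjF : adjacent false i.+1 i by [].
have jkT : blt true j1 (z1 j1) by rewrite z1j.
have jkF : blt false k1 (z1 k1) by rewrite z1k.
have sE : transp i.+1 i = s by rewrite transpC.
have hIT a : a \in I' <-> cover_cond true (conj_by s z1) (s j1) a by rewrite z1E sj1.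
have hLF a : a \in L' <-> cover_cond false (conj_by (transp i.+1 i) z1) (transp i.+1 i k1) a.
  by rewrite sE z1E sk1.
have TA := @transition_away V V^o t GV true z1 j1 i i.+1 fz1 jkT adjT desT zqp
  I I' sI hI sI' hIT.
have TO := @transition_opener V V^o t GV true z1 j1 i i.+1 fz1 jkT adjT desT zqp
  I I' sI hI sI' hIT.
have TC := @transition_closer V V^o t GV true z1 j1 i i.+1 fz1 jkT adjT desT zqp
  I I' sI hI sI' hIT.
have FA := @transition_away V V^o t GV false z1 k1 i.+1 i fz1 jkF adjF desF zqp'
  L L' sL hL sL' hLF.
have FO := @transition_opener V V^o t GV false z1 k1 i.+1 i fz1 jkF adjF desF zqp'
  L L' sL hL sL' hLF.
have FC := @transition_closer V V^o t GV false z1 k1 i.+1 i fz1 jkF adjF desF zqp'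
  L L' sL hL sL' hLF.
rewrite -/s z1E sj1 z1j in TA TO TC; rewrite sE z1E sk1 z1k in FA FO FC.
have b1 := bdivdiff_chain j1 I (fun w hw => @bdivdiff_demazure true i i.+1 w i hw adjT erefl) hz1.
have b2 := bdivdiff_chain k1 L (fun w hw => @bdivdiff_demazure false i.+1 i w i hw adjF erefl) hz1.
set f1 : V := csum j1 I z1 in IH b1 TO TC.
set f2 : V := csum k1 L z1 in IH b2 FO FC.
set g1 : V := chain_sum t (demazure t GV true i i.+1) j1 I z1 in b1 TA TO TC.
set g2 : V := chain_sum t (demazure t GV false i.+1 i) k1 L z1 in b2 FA FO FC.
set h1 : V := csum j I' z in TA TO TC *.
set h2 : V := csum (z j) L' z in FA FO FC *.
have sX a : a <> i -> a <> i.+1 -> sw i (1 + t * X a) = 1 + t * X a.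
  by move=> *; rewrite swD swM sw1 sw_beta sw_X_out.
have sB a : a <> i -> a <> i.+1 -> s a = a by move=> *; apply: transpN.
have n_Si : i <> i.+1 by apply: n_Sn.
have jkN : j1 <> k1 by move=> e; move: jk1; rewrite e ltnn.
(* With an endpoint at i+1, the left chain needs no correction. The term -beta f2 from
   [bdivdiff_xSi] is the correction of the right chain. *)
case: (eqVneq j1 i.+1) => [j1i|/eqP j1i].
  have k1i : k1 <> i by move: jk1; rewrite j1i; clear; lia.
  have k1i' : k1 <> i.+1 by rewrite -j1i; apply: nesym.
  have jE : j = i by rewrite -sj1 j1i /s transpR.
  have kE : z j = k1 by rewrite -sk1 sB.
  have TAe : g1 = h1 by apply: TA => //; rewrite j1i; apply: nesym.
  have FCe : g2 + t * f2 = h2 by apply: FC.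
  have b3 := bdivdiff_xSi (bdivdiffM (sX _ k1i k1i') b1).
  have E : (1 + t * X i.+1) * ((1 + t * X k1) * f1) = f2 by rewrite -IH j1i mulrA.
  rewrite E in b3; have := bdivdiff_uniq b3 b2.
  rewrite -FCe -TAe kE jE => <-; ring.
(* With an endpoint at i, the right chain needs no correction. The term beta f from [bdivdiff_xi] is
   the correction of the left chain. *)
case: (eqVneq j1 i) => [j1i'|/eqP j1i'].
  have k1i : k1 <> i by rewrite -j1i'; apply: nesym.
  have k1i' : k1 <> i.+1 by rewrite -z1j j1i'.
  have jE : j = i.+1 by rewrite -sj1 j1i' /s transpL.
  have kE : z j = k1 by rewrite -sk1 sB.
  have FAe : g2 = h2 by apply: FA.
  have TOe : g1 + t * f1 = h1 by apply: TO.
  have b3 := bdivdiff_xi (bdivdiffM (sX _ k1i k1i') b1).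
  have E : (1 + t * X i) * ((1 + t * X k1) * f1) = f2 by rewrite -IH j1i' mulrA.
  rewrite E in b3; have := bdivdiff_uniq b3 b2.
  rewrite -FAe -TOe kE jE => <-; ring.
case: (eqVneq k1 i.+1) => [k1i|/eqP k1i].
  have jE : j = j1 by rewrite -sj1 sB.
  have kE : z j = i by rewrite -sk1 k1i /s transpR.
  have TAe : g1 = h1 by apply: TA => //; rewrite k1i; apply: nesym.
  have FOe : g2 + t * f2 = h2 by apply: FO.
  have b3 := bdivdiff_xSi (bdivdiffM (sX _ j1i' j1i) b1).
  have E : (1 + t * X i.+1) * ((1 + t * X j1) * f1) = f2.
    by rewrite -IH k1i mulrA [(1 + t * X i.+1) * _]mulrC.
  rewrite E in b3.
  have := bdivdiff_uniq b3 b2.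
  rewrite -FOe -TAe kE jE => <-; ring.
case: (eqVneq k1 i) => [k1i'|/eqP k1i'].
  have jE : j = j1 by rewrite -sj1 sB.
  have kE : z j = i.+1 by rewrite -sk1 k1i' /s transpL.
  have FAe : g2 = h2 by apply: FA.
  have TCe : g1 + t * f1 = h1 by apply: TC.
  have b3 := bdivdiff_xi (bdivdiffM (sX _ j1i' j1i) b1).
  have E : (1 + t * X i) * ((1 + t * X j1) * f1) = f2.
    by rewrite -IH k1i' mulrA [(1 + t * X i) * _]mulrC.
  rewrite E in b3.
  have := bdivdiff_uniq b3 b2.
  rewrite -FAe -TCe kE jE => <-; ring.
have TAe : g1 = h1 by apply: TA.
have FAe : g2 = h2 by apply: FA.
have jE : j = j1 by rewrite -sj1 sB.
have kE : z j = k1 by rewrite -sk1 sB.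
have b3 := bdivdiffM (sX _ j1i' j1i) (bdivdiffM (sX _ k1i' k1i) b1).
rewrite mulrA IH in b3; have := bdivdiff_uniq b3 b2.
by rewrite -FAe -TAe kE jE => <-; rewrite mulrA.
Qed.

Lemma transition_supported m z : supported (2 * m) z -> IFPF z ->
  forall j, (j < z j)%N -> (z j < 2 * m)%N -> transition_at z j.
Proof.
move: z; apply: supported_ind.
  move=> _ j jk kn; apply: transition_top.
  by move: jk kn; rewrite /wrev; case: (ltnP j (2 * m)); lia.
move=> z i sz iN lt IH hz j jk kn; have [fz _ _] := sz.
have [e1 e2 ne ne' ex] := conj_ascent fz lt.
apply: (transition_step fz hz lt jk).
  by exists (2 * m)%N; split=> //; apply/andP.
have E : conj_by (transp i i.+1) z (transp i i.+1 j) = transp i i.+1 (z j).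
  by rewrite /conj_by /= transpK.
apply: IH; rewrite ?E; [exact: IFPF_conj | | apply: transp_lt => //; exact: ltnW].
have : blt true (transp i i.+1 j) (transp i i.+1 (z j)); last by [].
rewrite (@blt_transp true) // /blt jk /=.
by case: eqP => // ji; case: eqP => // ki; case: ne; rewrite ji in ki.
Qed.

Lemma transition z j : IFPF z -> (j < z j)%N -> transition_at z j.
Proof.
move=> hz jk; have [n0 hn] := IFPF_large hz.
apply: (@transition_supported (n0 + z j + 2)) => //; last by clear; lia.
by apply: hn; rewrite ?mul2n ?odd_double //; clear; lia.
Qed.
End Main.

(** * From operators on the span to chain sums, and the conclusion *)

Lemma sum_split_scale (K : comNzRingType) (M : lmodType K) (T : Type) (H : T -> M)
    m n (a : 'I_m -> K) (b : 'I_n -> K) (y : 'I_m -> T) (z : 'I_n -> T) (c : K) :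
  \sum_i a i *: H (y i) + c *: (\sum_i b i *: H (z i)) =
  \sum_(k < m + n)
    (match fintype.split k with inl i => a i | inr i => c * b i end) *:
      H (match fintype.split k with inl i => y i | inr i => z i end).
Proof.
rewrite [RHS]big_split_ord /= scaler_sumr; congr (_ + _); apply: eq_bigr => k _.
  by rewrite (unsplitK (inl k)).
by rewrite (unsplitK (inr k)) scalerA.
Qed.

Lemma scale_exchange (K : comNzRingType) (M : lmodType K) (c d : K) (f g f' g' : M) :
  f + c *: g + d *: (f' + c *: g') = f + d *: f' + c *: (g + d *: g').
Proof. by rewrite !scalerDr !scalerA [d * c]mulrC addrACA. Qed.

Section ActRight.
Variables (G : (nat -> nat) -> ZbetaX) (j : nat) (u : nat -> ZbetaX -> ZbetaX).
Hypothesis hu : forall i : nat, i != j -> is_u G i j (u i).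

Lemma in_span_G z : IFPF z -> in_span G (G z).
Proof.
move=> hz; exists 1%N, (fun=> 1), (fun=> z); split=> //.
by rewrite big_ord1 scale1r.
Qed.

Lemma in_spanD c f g : in_span G f -> in_span G g -> in_span G (f + c *: g).
Proof.
move=> [m [a [y [hy ->]]]] [n [b [z [hz ->]]]].
exists (m + n)%N, (fun k => match fintype.split k with inl i => a i | inr i => c * b i end),
  (fun k => match fintype.split k with inl i => y i | inr i => z i end).
split; first by move=> k; case: (fintype.split k).
exact: sum_split_scale.
Qed.

(** Linearity of the operators is given only on the span, so expanding their product requires every
    intermediate value to stay there. *)
Lemma u_span i f : i != j -> in_span G f -> in_span G (u i f).
Proof.
move=> ij; have [ul uG] := hu ij.
have sp0 : in_span G 0.
  by exists 0%N, (fun=> 0), (fun=> Theta); split=> [[]//|]; rewrite big_ord0.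
have u0 : u i 0 = 0.
  have := ul 1 0 0 sp0 sp0; rewrite !scale1r addr0 => /eqP.
  by rewrite -subr_eq subrr => /eqP.
move=> [n [c [z [hz ->]]]]; elim: n c z hz => [|n IH] c z hz.
  by rewrite big_ord0 u0.
rewrite big_ord_recl ul; first last.
- by exists n, (fun k => c (lift ord0 k)), (fun k => z (lift ord0 k)).
- exact: in_span_G.
rewrite addrC uG //; apply: in_spanD; last by apply/in_span_G/IFPF_conj.
exact: (IH (fun k => c (lift ord0 k)) (fun k => z (lift ord0 k))).
Qed.

Lemma act_right_linear (I : seq nat) c f g : all (fun a => a != j) I ->
  in_span G f -> in_span G g ->
  act_right (f + c *: g) [seq u a | a <- I] =
  act_right f [seq u a | a <- I] + c *: act_right g [seq u a | a <- I].
Proof.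
rewrite /act_right; elim: I f g => //= a I IH f g /andP[aj hI] hf hg.
have [ul _] := hu aj; have [hf' hg'] := (u_span aj hf, u_span aj hg).
have -> : u a (f + c *: g) = u a f + c *: u a g.
  by rewrite addrC ul // addrC.
rewrite scale_exchange; by apply: IH => //; apply: in_spanD.
Qed.

Lemma act_right_chain (I : seq nat) z : all (fun a => a != j) I -> IFPF z ->
  act_right (G z) [seq u a | a <- I] = chain_sum beta G j I z.
Proof.
elim: I z => //= a I IH z /andP[aj hI] hz.
rewrite -!IH //; last exact: IFPF_conj.
have [_ uG] := hu aj; rewrite -act_right_linear ?uG //; try exact: in_span_G.
by apply/in_span_G/IFPF_conj.
Qed.

End ActRight.

Lemma chain_sum_betaX (G : (nat -> nat) -> ZbetaX) j I z :
  chain_sum beta G j I z = chain_sum betaX (G : (nat -> nat) -> ZbetaX^o) j I z.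
Proof. by elim: I z => [//|a I IH] z /=; rewrite !IH scale_beta. Qed.

Lemma symplectic_family (G : (nat -> nat) -> ZbetaX) : symplectic_Grothendieck G ->
  @grothendieck_family ZbetaX_variable_ring G.
Proof.
case=> hT hS; split.
  move=> n n0 en; rewrite hT // /GSp_top /pair_prod big_mkord.
  apply: eq_bigr => a _; rewrite big_mkord big_mkcond /=; apply: eq_bigr => c _.
  rewrite /pair_term /pair_factor /= scale_beta.
  by have -> : (a.+1 + c.+1 <= n)%N = (a + c + 2 <= n)%N by lia.
move=> z i hz h1 h2 h3; have := hS z i hz; move/eqP: h1 => h1; move/eqP: h3 => h3.
move=> /(_ h1 h2 h3); rewrite /is_bdivdiff /is_divdiff (scale_beta (x_ i.+1)).
exact: id.
Qed.
Theorem theorem3p8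
    (G : (nat -> nat) -> ZbetaX)
    (hG : symplectic_Grothendieck G)
    (u : nat -> nat -> ZbetaX -> ZbetaX)
    (hu : forall i j : nat, i != j -> is_u G i j (u i j))
    (v : nat -> nat) (hv : IFPF v)
    (j k : nat) (hvk : v k = j) (hjk : (j < k)%N) (hvj : v j = k)
    (si sl : seq nat)
    (hsi_sorted : sorted ltn si)
    (hsi : forall i : nat,
       i \in si <-> (i < j)%N /\ fpf_cover v (conj_by (transp i j) v))
    (hsl_sorted : sorted gtn sl)
    (hsl : forall l : nat,
       l \in sl <-> (k < l)%N /\ fpf_cover v (conj_by (transp k l) v)) :
  (1 + beta *: x_ j) * (1 + beta *: x_ k)
    * act_right (G v) [seq u i j | i <- si]
  = act_right (G v) [seq u k l | l <- sl].
Proof.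
have hz := transition (symplectic_family hG) hv.
have jk : (j < v j)%N by rewrite hvj.
have [n0 hn] := IFPF_large hv.
have fits a : exists2 n, supported n v & (a < n)%N.
  exists (2 * (n0 + a.+1))%N; last by lia.
  by apply: hn; rewrite ?mul2n ?odd_double //; lia.
have left_mem a : a \in si <-> cover_cond true v j a.
  have [n sn an] := fits j.
  by rewrite hsi; apply: fpf_cover_left sn an jk.
have right_mem l : l \in sl <-> cover_cond false v (v j) l.
  rewrite hsl hvj; have [n sn ln] := fits l.
  by apply: fpf_cover_right sn ln _; rewrite hvk.
have main := hz j jk si sl hsi_sorted left_mem hsl_sorted right_mem.
rewrite hvj in main.
have left_neq : all (fun a => a != j) si.
  by apply/allP => a /left_mem[/= aj _ _ _]; rewrite neq_ltn aj.
have right_neq : all (fun l => l != k) sl.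
  apply/allP => l /right_mem[/= kl _ _ _]; rewrite hvj in kl.
  by rewrite neq_ltn kl orbT.
rewrite (@act_right_chain _ j (fun i => u i j)) //; last by move=> i; apply: hu.
rewrite (@act_right_chain _ k (u k)) //; last first.
  (* The right operators carry the fixed index first, while chains conjugate by the transposition of
     the letter and the fixed index. The transposition is the same. *)
  by move=> l lk; have := hu k l; rewrite eq_sym /is_u transpC; apply.
rewrite (chain_sum_betaX G j si v) (chain_sum_betaX G k sl v).
(* What still separates the two forms is scaling by [beta] against multiplication by [betaX] in the
   two linear factors. *)
have e a := congr1 (fun f : ZbetaX => 1 + f) (scale_beta (x_ a)).
have {}e := f_equal2 (fun f g : ZbetaX =>
  f * g * (chain_sum betaX (G : (nat -> nat) -> ZbetaX^o) j si v : ZbetaX)) (e j) (e k).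
exact: etrans e main.
Qed.
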